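(* Let $k,\ell\ge1$ be integers and let $p=cn^{-1}$ for some fixed $c>0$. Let $G_{n,p}$ be an Erdős–Rényi graph with parameters $n$ and $p$. Then $$\lim_{n\to\infty}\frac{\mathbb{E}[\mathrm{rk}(\mathrm{MH}_{k,\ell}(G_{n,p}))]}{n}=c\,\delta_{k,\ell},$$ where $\delta_{k,\ell}$ is the Kronecker delta. Moreover, for any $\varepsilon>0$, $$\lim_{n\to\infty}\mathbb{P}\left(\left|\frac{\mathrm{rk}(\mathrm{MH}_{k,\ell}(G_{n,p}))}{n}-c\,\delta_{k,\ell}\right|>\varepsilon\right)=0.$$
   Context: The Erdős–Rényi graph $G_{n,p}$ is the random graph on $n$ labelled vertices in which each pair of distinct vertices is joined by an edge independently with probability $p$. $\mathrm{rk}$ denotes the rank of a finitely generated abelian group. A graph means a finite simple undirected graph without loops. In a graph $G$ with vertex set $V(G)$, let $d(x,y)$ be the length of a shortest path between $x$ and $y$ ($\infty$ if there is none), and $L(x_0,\dots,x_k)=\sum_{i=1}^k d(x_{i-1},x_i)$. For integers $k,\ell\ge 0$, $\mathrm{MC}_{k,\ell}(G)$ is the free $\mathbb{Z}$-module generated by the tuples $(x_0,\dots,x_k)\in V(G)^{k+1}$ with $x_{i-1}\ne x_i$ for all $1\le i\le k$ and $L(x_0,\dots,x_k)=\ell$; $\mathrm{MC}_{-1,\ell}(G)=0$. The boundary map $\partial_{k,\ell}:\mathrm{MC}_{k,\ell}(G)\to\mathrm{MC}_{k-1,\ell}(G)$ is given for $k\ge1$ by $\partial_{k,\ell}(x_0,\dots,x_k)=\sum_{i}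 (-1)^i (x_0,\dots,\hat{x}_i,\dots,x_k)$, the sum over those $1\le i\le k-1$ with $d(x_{i-1},x_{i+1})=d(x_{i-1},x_i)+d(x_i,x_{i+1})$ (the hat means deletion), and $\partial_{0,\ell}=0$. The magnitude homology is $\mathrm{MH}_{k,\ell}(G)=\ker\partial_{k,\ell}/\mathrm{Im}\,\partial_{k+1,\ell}$. *)

(* Defs.v *)
From HB Require Import structures.
From mathcomp Require Import all_boot all_order all_algebra.
From mathcomp Require Import ring_quotient.
From mathcomp Require Import all_classical all_reals all_analysis.

Set Implicit Arguments.
Unset Strict Implicit.
Unset Printing Implicit Defensive.

Import Order.TTheory GRing.Theory Num.Theory.

Local Open Scope ring_scope.

Section SimpleGraphs.
Variable V : finType.

Definition vpairs : {set {set V}} := [set e : {set V} | #|e| == 2%N].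

Record sgraph := SGraph {
  edges : {set {set V}};
  _ : edges \subset vpairs
}.

HB.instance Definition _ := [isSub for edges].
HB.instance Definition _ := [Finite of sgraph by <:].

Definition adj (G : sgraph) : rel V := fun x y => [set x; y] \in edges G.

Definition joined (G : sgraph) (x y : V) (m : nat) : bool :=
  [exists p : m.-tuple V, path (adj G) x p && (last x p == y)].

(* [None] stands for the distance infinity. A shortest walk is a path, so
   minimising over walks is harmless. *)
Definition dist (G : sgraph) (x y : V) : option nat :=
  if pselect (exists m, joined G x y m) is left ex then Some (ex_minn ex)
  else None.

End SimpleGraphs.

(* Addition of distances: infinity is absorbing. *)
Definition dadd (a b : option nat) : option nat :=
  if (a, b) is (Some m, Some n) then Some (m + n)%N else None.

Section MagnitudeHomology.
Variables (V : finType) (G : sgraph V).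

(* The entry x_i of x = (x_0, ..., x_k); only used for i <= k. *)
Definition entry (k : nat) (x : k.+1.-tuple V) (i : nat) : V :=
  tnth x (inord i).

Definition mlength (k : nat) (x : k.+1.-tuple V) : option nat :=
  \big[dadd/Some 0%N]_(i < k) dist G (entry x i) (entry x i.+1).

Definition is_mgen (k l : nat) (x : k.+1.-tuple V) : bool :=
  [forall i : 'I_k, entry x i != entry x i.+1] && (mlength x == Some l).

Definition mgen (k l : nat) : finType := {x : k.+1.-tuple V | is_mgen l x}.

Definition MC (k l : nat) : zmodType := {ffun mgen k l -> int}.

(* The basis element of a tuple (0 if the tuple is not a generator, which does
   not happen for the faces occurring in the boundary below). *)
Definition basis_elt (k l : nat) (t : k.+1.-tuple V) : MC k l :=
  [ffun y : mgen k l => (val y == t)%:R].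

Definition del_entry (k : nat) (x : k.+2.-tuple V) (i : 'I_k.+2) :
    k.+1.-tuple V :=
  [tuple tnth x (lift i j) | j < k.+1].

Definition smooth (k : nat) (x : k.+2.-tuple V) (i : 'I_k.+2) : bool :=
  dist G (entry x i.-1) (entry x i.+1) ==
    dadd (dist G (entry x i.-1) (entry x i)) (dist G (entry x i) (entry x i.+1)).

Definition gen_boundary (k l : nat) (x : k.+2.-tuple V) : MC k l :=
  \sum_(i < k.+2 | (0 < i < k.+1)%N && smooth x i)
    basis_elt l (del_entry x i) *~ (-1) ^+ i.

(* [boundary k l] is the map from degree k+1 to degree k. *)
Definition boundary (k l : nat) (f : MC k.+1 l) : MC k l :=
  \sum_(x : mgen k.+1 l) gen_boundary l (val x) *~ f x.

Lemma boundary_is_zmod_morphism k l : zmod_morphism (@boundary k l).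
Proof.
move=> f g; rewrite /boundary -sumrB; apply: eq_bigr => x _.
by rewrite !ffunE mulrzBr.
Qed.

HB.instance Definition _ k l :=
  GRing.isZmodMorphism.Build (MC k.+1 l) (MC k l) (@boundary k l)
    (@boundary_is_zmod_morphism k l).

(* In degree 0 the boundary map is zero, so that every chain is a cycle. *)
Definition is_cycle (k l : nat) : MC k l -> bool :=
  if k is k'.+1 then fun f => boundary f == 0 else fun=> true.

Lemma is_cycle_zmod_closed k l : zmod_closed (@is_cycle k l).
Proof.
case: k => [|k]; split => //; first by apply/eqP; exact: raddf0.
move=> f g /eqP f0 /eqP g0; apply/eqP.
by rewrite raddfB/= f0 g0 subrr.
Qed.

HB.instance Definition _ k l :=
  GRing.isZmodClosed.Build (MC k l) (@is_cycle k l) (@is_cycle_zmod_closed k l).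

Record cycle (k l : nat) := Cycle {
  chain_of_cycle :> MC k l;
  _ : is_cycle chain_of_cycle
}.

HB.instance Definition _ k l := [isSub for @chain_of_cycle k l].
HB.instance Definition _ k l := [Choice of cycle k l by <:].
HB.instance Definition _ k l := [SubChoice_isSubZmodule of cycle k l by <:].

(* The image of the boundary consists of cycles, so no element of it is lost by
   testing membership on cycles only. *)
Definition is_boundary (k l : nat) (z : cycle k l) : bool :=
  `[< exists f : MC k.+1 l, chain_of_cycle z = boundary f >].

Lemma is_boundary_zmod_closed k l : zmod_closed (@is_boundary k l).
Proof.
split; first by apply/asboolP; exists 0; rewrite !raddf0.
move=> y z /asboolP[f yf] /asboolP[g zg]; apply/asboolP.
by exists (f - g); rewrite raddfB/= -yf -zg.
Qed.

HB.instance Definition _ k l :=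
  GRing.isZmodClosed.Build (cycle k l) (@is_boundary k l)
    (@is_boundary_zmod_closed k l).

Definition MH (k l : nat) : zmodType :=
  Quotient.quot (GRing.ZmodClosed.clone (cycle k l) (@is_boundary k l) _).

End MagnitudeHomology.

Definition int_free (A : zmodType) (r : nat) (v : 'I_r -> A) : Prop :=
  forall a : 'I_r -> int, \sum_(i < r) v i *~ a i = 0 -> forall i, a i = 0.

(* The maximal size of an integrally free family (0 if there is no maximum,
   which cannot happen in a finitely generated group). *)
Definition abrank (A : zmodType) : nat :=
  xget 0%N [set r : nat |
    (exists v : 'I_r -> A, int_free v) /\
    (forall (s : nat) (v : 'I_s -> A), int_free v -> (s <= r)%N)]%classic.

Section ErdosRenyi.
Local Open Scope classical_set_scope.
Context d (T : measurableType d) (R : realType) (P : probability T R).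

Definition mutually_independent (I : finType) (D : {set I})
    (E : I -> set T) : Prop :=
  (forall i, i \in D -> measurable (E i)) /\
  (forall A : {set I}, A \subset D ->
     P (\bigcap_(i in [set` A]) E i) = (\prod_(i in A) P (E i))%E).

Definition edge_event (V : finType) (G : T -> sgraph V) (e : {set V}) : set T :=
  [set w | e \in edges (G w)].

Definition erdos_renyi (n : nat) (p : R) (G : T -> sgraph 'I_n) : Prop :=
  mutually_independent (vpairs 'I_n) (edge_event G) /\
  (forall e, e \in vpairs 'I_n -> P (edge_event G e) = p%:E).

End ErdosRenyi.

(* Main.v *)
(* The complex MC_{*,l}(G) carries an acyclic matching.  Scan a tuple from the
   left along its longest initial zigzag a, b, a, b, ... of edges.  If the first
   deviation is a smooth entry, delete it; if it is a step of length at least 2,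
   insert the next vertex of a geodesic.  On tuples for which the geodesics
   involved have a unique first step, these two operations are mutually inverse,
   and the corresponding block of the boundary matrix is a signed permutation
   matrix.  Hence rk MH_{k,l} is at most the number of zigzags of length k = l,
   i.e. delta_{k,l} times the number A of ordered pairs of adjacent vertices,
   plus the number of irregular tuples.  Conversely the zigzags are independent
   cycles and MC_{k+1,k} = 0, so rk MH_{k,k} >= A.

   An irregular tuple lies near a cycle: some edge {a, a'} can be avoided by a
   bounded walk through all entries of the tuple and through a and a'.  The
   vertices of such a walk span at least as many edges as there are vertices, so
   the expected number of these walks is bounded uniformly in n when p = c/n.
   Finally A/n tends to c in mean square, so rk MH_{k,l} / n tends to
   c delta_{k,l} in L^1, which gives both claims. *)

Require Import Defs.
From HB Require Import structures.
From mathcomp Require Import all_boot all_order all_algebra.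
From mathcomp Require Import ring_quotient generic_quotient.
From mathcomp Require Import zify ring lra.
From mathcomp Require Import all_classical all_reals all_analysis.
Import Order.TTheory GRing.Theory Num.Theory.
Import numFieldNormedType.Exports.
Import Defs.

Set Implicit Arguments.
Unset Strict Implicit.
Unset Printing Implicit Defensive.

Local Open Scope nat_scope.

(* [lia] is slow in a context with many boolean hypotheses, and does not
   recognise equalities over the canonical eqType of [nat]. *)
Ltac nat_lia :=
  repeat match goal with H : @eq ?T ?a ?b |- _ => lazymatch T with
    | nat => fail
    | _ => change (@eq nat a b) in H
    end end;
  repeat match goal with H : ?T |- _ => lazymatch T with
    | nat => fail
    | ordinal _ => fail
    | is_true (leq _ _) => fail
    | is_true (leq _ _ && leq _ _) => fail
    | is_true (~~ (_ == _)) => fail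
    | @eq nat _ _ => fail
    | _ => clear H
    end end; lia.

(** * Distances and walks *)

Lemma daddA : associative dadd.
Proof. by case=> [a|] [b|] [c|] //=; rewrite /dadd addnA. Qed.

Lemma daddC : commutative dadd.
Proof. by case=> [a|] [b|] //=; rewrite /dadd addnC. Qed.

Lemma dadd0 : left_id (Some 0) dadd.
Proof. by case. Qed.

HB.instance Definition _ := Monoid.isComLaw.Build (option nat) (Some 0) dadd
  daddA daddC dadd0.

Section Distance.
Variables (V : finType) (G : sgraph V).
Implicit Types (x y z u w : V).

Lemma adj_sym : symmetric (adj G).
Proof. by move=> x y; rewrite /adj finset.setUC. Qed.

Lemma edges_vpairs : edges G \subset vpairs V.
Proof. by case: G. Qed.

Lemma adj_neq x y : adj G x y -> x != y.
Proof.
move=> /(fintype.subsetP edges_vpairs); rewrite inE cards2.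
by case: (x == y).
Qed.

Lemma joinedP x y m :
  reflect (exists p, [/\ size p = m, path (adj G) x p & last x p = y])
          (joined G x y m).
Proof.
apply: (iffP existsP) => [[p /andP[xp /eqP py]]|[p [sp xp py]]].
  by exists p; rewrite size_tuple.
by move/eqP: sp => sp; exists (Tuple sp); rewrite /= xp py eqxx.
Qed.

Lemma dist_someP x y m :
  dist G x y = Some m <->
  joined G x y m /\ (forall m', joined G x y m' -> m <= m').
Proof.
rewrite /dist; case: pselect => [ex|nex]; split => //.
- by move=> [<-]; case: ex_minnP.
- case: ex_minnP => m' jm' mm' [jm mm]; congr Some; apply/eqP.
  by rewrite eqn_leq mm'// mm.
- by move=> [jm _]; exfalso; apply: nex; exists m.
Qed.

Lemma joined_dist x y m :
  joined G x y m -> exists2 d, dist G x y = Some d & d <= m.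
Proof.
move=> jm; have ex : exists m, joined G x y m by exists m.
exists (ex_minn ex); case: ex_minnP => d jd md; last exact: md.
exact/dist_someP.
Qed.

Lemma dist_joined x y m : dist G x y = Some m -> joined G x y m.
Proof. by move=> /dist_someP[]. Qed.

Lemma dist_le x y m d : dist G x y = Some d -> joined G x y m -> d <= m.
Proof. by move=> /dist_someP[_]; apply. Qed.

Lemma joined_sym x y m : joined G x y m -> joined G y x m.
Proof.
move=> /joinedP[p [sp xp py]]; apply/joinedP; exists (rev (belast x p)).
rewrite size_rev size_belast; split => //.
  rewrite -py rev_path; congr is_true: xp; apply: eq_path => u w.
  exact: adj_sym.
case: p {sp xp} py => //= z p _.
by rewrite rev_cons last_rcons.
Qed.

Lemma dist_sym x y : dist G x y = dist G y x.
Proof.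
have sym u w m : dist G u w = Some m -> dist G w u = Some m.
  move=> /dist_someP[juw muw]; apply/dist_someP; split.
    exact: joined_sym.
  by move=> m' /joined_sym; exact: muw.
case dxy : (dist G x y) => [m|]; first by rewrite (sym _ _ _ dxy).
by case dyx : (dist G y x) => [m|//]; rewrite (sym _ _ _ dyx) in dxy.
Qed.

Lemma dist_triangle x y z a b :
  dist G x y = Some a -> dist G y z = Some b ->
  exists2 d, dist G x z = Some d & d <= a + b.
Proof.
move=> /dist_joined/joinedP[p [sp xp py]] /dist_joined/joinedP[q [sq yq qz]].
apply: joined_dist; apply/joinedP; exists (p ++ q).
by rewrite size_cat sp sq cat_path last_cat py xp yq.
Qed.

Lemma dist_xx x : dist G x x = Some 0.
Proof. by apply/dist_someP; split => //; apply/joinedP; exists [::]. Qed.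

Lemma dist_eq0 x y : (dist G x y == Some 0) = (x == y).
Proof.
apply/eqP/eqP => [/dist_joined/joinedP[p [/size0nil -> _ //]]|->].
exact: dist_xx.
Qed.

Lemma dist_eq1 x y : (dist G x y == Some 1) = adj G x y.
Proof.
apply/eqP/idP => [/dist_joined/joinedP[[|u [|? ?]] [//= _]]|xy].
  by rewrite andbT => + <-.
apply/dist_someP; split.
  by apply/joinedP; exists [:: y]; rewrite /= xy.
case=> // /joinedP[p [/size0nil -> _ /= xy']].
by have := adj_neq xy; rewrite xy' eqxx.
Qed.

Lemma dist_step x y d :
  dist G x y = Some d.+1 ->
  exists2 u, adj G x u & dist G u y = Some d.
Proof.
move=> dxy; have /joinedP[[|u p] [//= [sp] /andP[xu up] py]] := dist_joined dxy.
exists u => //; apply/dist_someP; split.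
  by apply/joinedP; exists p.
move=> m /joinedP[q [sq uq qy]]; rewrite -ltnS.
apply: (dist_le dxy); apply/joinedP; exists (u :: q).
by rewrite /= sq xu uq.
Qed.

(** Uniqueness of the first step of a geodesic makes the insertion of a vertex well defined, hence
    inverse to deletion. *)
Definition unique_step (a b : V) : bool :=
  [forall u, forall w,
    [&& adj G a u, adj G a w, dist G a b == dadd (Some 1) (dist G u b)
      & dist G a b == dadd (Some 1) (dist G w b)] ==> (u == w)].

Lemma unique_stepP a b u w :
  unique_step a b -> adj G a u -> adj G a w ->
  dist G a b = dadd (Some 1) (dist G u b) ->
  dist G a b = dadd (Some 1) (dist G w b) -> u = w.
Proof.
move=> /forallP/(_ u)/forallP/(_ w)/implyP H au aw du dw.
by apply/eqP/H; rewrite au aw -du -dw eqxx.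
Qed.

(** Standing still is allowed, so a walk can be padded to any larger length and all walks can be
    given one common length. *)
Definition lazy_avoiding (a b : V) : rel V :=
  fun x y => (x == y) || adj G x y && ([set x; y] != [set a; b]).

End Distance.

Section LazyWalks.
Variables (V : finType) (e : rel V).
Hypothesis e_refl : reflexive e.

Definition walk x y m := exists p, [/\ size p = m, path e x p & last x p = y].

Lemma walk_cat x y z m n : walk x y m -> walk y z n -> walk x z (m + n).
Proof.
move=> [p [sp xp py]] [q [sq yq qz]]; exists (p ++ q).
by rewrite size_cat sp sq cat_path last_cat py xp yq.
Qed.

Lemma walk_refl x m : walk x x m.
Proof.
exists (nseq m x); rewrite size_nseq; split => //; elim: m => //= m.
by rewrite e_refl.
Qed.

Lemma walk_leq x y m n : m <= n -> walk x y m -> walk x y n.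
Proof. by move=> /subnKC <- xy; apply: walk_cat xy (walk_refl _ _). Qed.

Lemma walk_sym x y m : symmetric e -> walk x y m -> walk y x m.
Proof.
move=> e_sym [p [sp xp py]]; exists (rev (belast x p)).
rewrite size_rev size_belast; split => //.
  rewrite -py rev_path; congr is_true: xp; apply: eq_path => u w.
  exact: e_sym.
case: p {sp xp} py => //= z p _.
by rewrite rev_cons last_rcons.
Qed.

Lemma walk_path (e' : rel V) n x p :
  (forall u w, e' u w -> walk u w n) -> path e' x p ->
  walk x (last x p) (size p * n).
Proof.
move=> ee'; elim: p x => [|y p IH] x /=; first by move=> _; exact: walk_refl.
by move=> /andP[xy yp]; rewrite mulSn; apply: walk_cat (ee' _ _ xy) (IH _ yp).
Qed.

End LazyWalks.

(** * Detours around an edge *)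

Section Detours.
Variables (V : finType) (G : sgraph V).
Implicit Types (x y z u w : V).

Lemma lazy_avoiding_refl (a b : V) : reflexive (lazy_avoiding G a b).
Proof. by move=> x; rewrite /lazy_avoiding eqxx. Qed.

Lemma lazy_avoiding_sym (a b : V) : symmetric (lazy_avoiding G a b).
Proof.
by move=> x y; rewrite /lazy_avoiding eq_sym adj_sym (finset.setUC [set x]).
Qed.

(** After its start, a geodesic to [y] only visits vertices at distance less than [d] from [y]. It
    therefore never meets [a], and cannot use an edge at [a]. *)
Lemma geodesic_avoids (a a' x y : V) d e :
  dist G x y = Some d -> dist G a y = Some e -> d <= e -> x != a ->
  walk (lazy_avoiding G a a') x y d.
Proof.
move=> + ay; elim: d x => [|d IH] x xy de xa.
  have /eqP -> : x == y by rewrite -(dist_eq0 G) xy.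
  move=> *; exact/walk_refl/lazy_avoiding_refl.
have [u xu uy] := dist_step xy.
have ua : u != a.
  by apply: contraTneq de => ua; move: uy; rewrite ua ay => -[->]; rewrite ltnn.
have xu1 : walk (lazy_avoiding G a a') x u 1.
  exists [:: u]; rewrite /= /lazy_avoiding xu andbT; split => //.
  apply/orP; right; apply/eqP => /setP/(_ a).
  by rewrite !inE eqxx !(eq_sym a) (negbTE xa) (negbTE ua).
by have := walk_cat xu1 (IH _ uy (ltnW de) ua).
Qed.

(** Only the edge joining [a] and [a'] needs the detour, possibly reversed; any other edge is a
    single step followed by lazy ones. *)
Lemma walk_detour (a a' x y : V) n :
  0 < n -> walk (lazy_avoiding G a a') a a' n -> adj G x y ->
  walk (lazy_avoiding G a a') x y n.
Proof.
move=> n0 aa' xy.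
have [/setP exy|nxy] := eqVneq [set x; y] [set a; a']; last first.
  apply: (walk_leq (lazy_avoiding_refl _ _) n0); exists [:: y].
  by rewrite /= /lazy_avoiding xy nxy orbT.
have := exy x; have := exy y; have := adj_neq xy.
have := exy a; have := exy a'; rewrite !inE !eqxx ?orbT /=.
have [->|_] := eqVneq x a.
  by have [-> //|_] := eqVneq y a; have [->|] := eqVneq y a'.
have [->|//] := eqVneq x a'.
have [->|ya] := eqVneq y a.
  by move=> *; apply: walk_sym => //; exact: lazy_avoiding_sym.
by have [->|] := eqVneq y a'.
Qed.

Lemma joined_detour (a a' x y : V) m n :
  0 < n -> walk (lazy_avoiding G a a') a a' n -> joined G x y m ->
  walk (lazy_avoiding G a a') x y (m * n).
Proof.
move=> n0 aa' /joinedP[p [<- xp <-]].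
apply: walk_path xp; first exact: lazy_avoiding_refl.
by move=> u w; exact: walk_detour.
Qed.

End Detours.

(** * The acyclic matching *)

Section Entries.
Variables (V : finType) (G : sgraph V).

Lemma entry_del k (x : k.+2.-tuple V) (i : 'I_k.+2) j :
  j <= k -> entry (del_entry x i) j = entry x (bump i j).
Proof.
move=> jk; rewrite /entry /del_entry tnth_mktuple; congr (tnth x _).
have jk1 : j < k.+1 by [].
apply: val_inj; rewrite /= inordK// inordK// /bump.
by have := ltn_ord i; case: leqP; lia.
Qed.

Lemma entry_inj k (x y : k.+1.-tuple V) :
  (forall i, i <= k -> entry x i = entry y i) -> x = y.
Proof.
move=> exy; apply: eq_from_tnth => i; have := exy i.
by rewrite /entry inord_val; apply; rewrite -ltnS.
Qed.

Lemma mlength_bound k (x : k.+1.-tuple V) l i :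
  mlength G x = Some l -> i < k ->
  exists2 d, dist G (entry x i) (entry x i.+1) = Some d & d <= l.
Proof.
move=> + ik; rewrite /mlength (bigD1 (Ordinal ik))//=.
case: (dist _ _ _) => [d|//]; case: (\big[_/_]_(_ < _ | _) _) => // m [<-].
by exists d; rewrite // leq_addr.
Qed.

Lemma is_mgenP k l (x : k.+1.-tuple V) :
  reflect ((forall i, i < k -> entry x i != entry x i.+1) /\
           mlength G x = Some l)
          (is_mgen G l x).
Proof.
apply: (iffP andP) => [[/forallP xN /eqP xl]|[xN xl]]; split => //.
- by move=> i ik; exact: (xN (Ordinal ik)).
- by apply/forallP => i; exact/xN/ltn_ord.
- exact/eqP.
Qed.

Lemma mgen_dist k l (x : k.+1.-tuple V) i : is_mgen G l x -> i < k ->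
  exists2 d, dist G (entry x i) (entry x i.+1) = Some d & 0 < d <= l.
Proof.
move=> /is_mgenP[xN xl] ik; have [d dx dl] := mlength_bound xl ik.
exists d; rewrite // dl andbT lt0n; apply: contraNneq (xN _ ik) => d0.
by rewrite -(dist_eq0 G) dx d0.
Qed.

Lemma mlength_del k (x : k.+2.-tuple V) (i : 'I_k.+2) :
  0 < i < k.+1 -> smooth G x i -> mlength G (del_entry x i) = mlength G x.
Proof.
case: i => -[//|i] ik2 /= ik /eqP /= sx.
have ik' : i < k by [].
have ik1 : i.+1 < k.+1 by [].
rewrite /mlength (bigD1 (Ordinal ik'))//=.
rewrite [in RHS](bigD1_ord (Ordinal ik1))//=.
rewrite [in RHS](bigD1 (Ordinal ik'))//= [RHS]daddA; congr dadd.
  rewrite !entry_del ?(ltnW ik')//=.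
  have -> : bump i.+1 i = i by rewrite /bump ltnn.
  have -> : bump i.+1 i.+1 = i.+2 by rewrite /bump leqnn.
  by rewrite sx daddC.
apply: eq_bigr => j; rewrite -val_eqE/= => ji.
rewrite (entry_del _ _ (ltn_ord j)) (entry_del _ _ (ltnW (ltn_ord j))).
congr (dist _ _ (entry _ _)).
by move/eqP: ji; rewrite /bump /=; do 2 case: leqP; lia.
Qed.

End Entries.

Section Cells.
Variables (V : finType) (G : sgraph V).
Implicit Types (s : nat -> V).

(** Cells are described for functions on [nat], so that tuples of different degrees can be compared
    on a common prefix. *)
Definition zigzag s m : bool :=
  [forall j : 'I_m, adj G (s j) (s j.+1) && ((j.+1 < m) ==> (s j.+2 == s j))].

Lemma zigzagP s m :
  reflect ((forall j, j < m -> adj G (s j) (s j.+1)) /\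
           (forall j, j.+1 < m -> s j.+2 = s j))
          (zigzag s m).
Proof.
apply: (iffP forallP) => [sm|[sm1 sm2] j].
  split=> j jm; first by have /andP[] := sm (Ordinal jm).
  by have /andP[_ /implyP/(_ jm)/eqP] := sm (Ordinal (ltnW jm)).
by rewrite sm1//=; apply/implyP => /sm2 ->.
Qed.

Lemma eq_zigzag s s' m :
  (forall j, j <= m -> s j = s' j) -> zigzag s m = zigzag s' m.
Proof.
move=> ss'; apply/zigzagP/zigzagP => -[s1 s2]; split => j jm.
- by rewrite -!ss' ?s1// ltnW.
- by rewrite -!ss' ?s2//; lia.
- by rewrite !ss' ?s1// ltnW.
- by rewrite !ss' ?s2//; lia.
Qed.

Lemma zigzag_leq s m n : m <= n -> zigzag s n -> zigzag s m.
Proof.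
move=> mn /zigzagP[s1 s2]; apply/zigzagP; split => j jm.
  by apply: s1; lia.
by apply: s2; lia.
Qed.

(* Deleting the entry i+1 matches the up-cells of index i in degree k+1 with the
   down-cells of index i in degree k. *)
Definition up_cell k s i : bool :=
  [&& i.+1 < k, zigzag s i.+1,
      dist G (s i) (s i.+2) == dadd (Some 1) (dist G (s i.+1) (s i.+2))
    & unique_step G (s i) (s i.+2)].

(** For positive [i] some geodesic along the deviating step first turns back to [s i.-1]. Inserting
    its first vertex thus prolongs the zigzag by one edge. *)
Definition down_cell k s i : bool :=
  [&& i < k, zigzag s i, dist G (s i) (s i.+1) != Some 1,
      (0 < i) ==>
        (dist G (s i) (s i.+1) == dadd (Some 1) (dist G (s i.-1) (s i.+1)))
    & unique_step G (s i) (s i.+1)].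

Lemma eq_down_cell k k' s s' i : i < k' -> (forall j, j <= i.+1 -> s j = s' j) ->
  down_cell k s i -> down_cell k' s' i.
Proof.
move=> ik' ss' /and5P[ik si d1 di ui]; apply/and5P; split => //.
- by rewrite -(@eq_zigzag s)// => j ji; apply: ss'; lia.
- by rewrite -!ss'.
- by rewrite -!ss'//; lia.
- by rewrite -!ss'.
Qed.

Lemma up_cell_noreturn k s i : up_cell k s i -> s i.+2 <> s i.
Proof.
by move=> /and4P[_ _ + _] e; rewrite e dist_xx; case: dist.
Qed.

(** The zigzag belonging to the larger index would force a return right after the smaller one, which
    [up_cell_noreturn] forbids. *)
Lemma up_cell_index k s i j : up_cell k s i -> up_cell k s j -> i = j.
Proof.
wlog ij : i j / i < j => [H ui uj|ui].
  by have [ij|ji|//] := ltngtP i j; [exact: H | apply/esym/H].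
by move=> /and4P[_ /zigzagP[_ sj] _ _]; case: (up_cell_noreturn ui); exact: sj.
Qed.

(** If [j <= i], step [j] is an edge of the zigzag of the up-cell. If [j > i.+1], the zigzag of the
    down-cell forces a return. If [j = i.+1], each of two finite distances would exceed the other by
    1. *)
Lemma up_downF k s i j :
  (forall t, t < k -> dist G (s t) (s t.+1) <> None) ->
  up_cell k s i -> down_cell k s j -> False.
Proof.
move=> fin ui /and5P[jk sj d1 dj _].
have /and4P[ik /zigzagP[s1 s2] di _] := ui.
have [ji|ij|ji] := ltngtP j i.+1.
- by move: d1; rewrite dist_eq1 s1.
- by apply: (up_cell_noreturn ui); have /zigzagP[_] := sj; apply.
- rewrite ji /= in dj; move: (fin _ ik) (eqP di) (eqP dj).
  case: (dist _ (s i.+1) _) => // a _; case: (dist _ (s i) _) => [b|//].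
  by rewrite /dadd => -[? ] [?]; lia.
Qed.

End Cells.

Section Matching.
Variables (V : finType) (G : sgraph V).

Lemma is_mgen_del k l (x : k.+2.-tuple V) (i : 'I_k.+2) :
  0 < i < k.+1 -> smooth G x i -> is_mgen G l x -> is_mgen G l (del_entry x i).
Proof.
move=> ik sx gx; have /is_mgenP[xN xl] := gx.
apply/is_mgenP; split; last by rewrite mlength_del.
move=> j jk; rewrite (entry_del _ _ jk) (entry_del _ _ (ltnW jk)).
have [ji|ji|ji] := ltngtP j.+1 i.
- have -> : bump i j.+1 = (bump i j).+1 by rewrite /bump; do 2 case: leqP; lia.
  by apply: xN; rewrite /bump; case: leqP; lia.
- have -> : bump i j.+1 = (bump i j).+1 by rewrite /bump; do 2 case: leqP; lia.
  by apply: xN; rewrite /bump; case: leqP; lia.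
have -> : bump i j.+1 = i.+1 by rewrite /bump; case: leqP; lia.
have -> : bump i j = i.-1 by rewrite /bump; case: leqP; lia.
apply: contraTneq sx; rewrite /smooth => <-; rewrite dist_xx.
have i1k : i.-1 < k.+1 by lia.
have [a + /andP[a0 _]] := mgen_dist gx i1k; rewrite prednK; last by lia.
by move=> ->; case: dist => // b; apply/eqP => -[]; lia.
Qed.

Lemma entry_del_lt k (x : k.+2.-tuple V) i j : j <= i -> i <= k ->
  entry (del_entry x (inord i.+1)) j = entry x j.
Proof.
move=> ji ik; rewrite entry_del; last exact: leq_trans ik.
by rewrite /bump inordK; [rewrite ltnNge ji | lia].
Qed.

Lemma entry_del_gt k (x : k.+2.-tuple V) i j : i < j -> j <= k ->
  entry (del_entry x (inord i.+1)) j = entry x j.+1.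
Proof.
move=> ij jk; rewrite entry_del//.
by rewrite /bump inordK; [rewrite ij | lia].
Qed.

Lemma up_cell_smooth k (x : k.+2.-tuple V) i :
  up_cell G k.+1 (entry x) i -> smooth G x (inord i.+1).
Proof.
move=> /and4P[ik /zigzagP[s1 _] /eqP d _]; rewrite /smooth inordK; last by lia.
by have /eqP := s1 _ (ltnSn i); rewrite /= d -[adj _ _ _](dist_eq1) => /eqP/eqP ->.
Qed.

Lemma up_cell_del k l (x : k.+2.-tuple V) i :
  is_mgen G l x -> up_cell G k.+1 (entry x) i ->
  is_mgen G l (del_entry x (inord i.+1)) /\
  down_cell G k (entry (del_entry x (inord i.+1))) i.
Proof.
move=> gx ux; have sx := up_cell_smooth ux.
have /and4P[ik ax /eqP dx qx] := ux; have /zigzagP[s1 s2] := ax.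
split; first by apply: is_mgen_del => //; rewrite inordK; lia.
have ik' : i < k by [].
have e1 : entry (del_entry x (inord i.+1)) i = entry x i.
  by rewrite entry_del_lt// ltnW.
have e2 : entry (del_entry x (inord i.+1)) i.+1 = entry x i.+2.
  by rewrite entry_del_gt.
apply/and5P; rewrite e1 e2 dx; split => //.
- rewrite (@eq_zigzag _ _ _ (entry x)).
    exact: zigzag_leq (leqnSn i) ax.
  by move=> j ji; rewrite entry_del_lt// ltnW.
- have [a -> /andP[a0 _]] := mgen_dist gx ik.
  by apply/eqP => -[a1]; lia.
- apply/implyP => i0; rewrite entry_del_lt; [|lia|lia].
  by have := s2 i.-1; rewrite prednK// => -> //; lia.
Qed.

(** The inverse of deletion: the new entry [u] is the first vertex of a geodesic along step [i],
    whose length is at least 2. *)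
Lemma down_cell_insert k l (y : k.+1.-tuple V) i :
  is_mgen G l y -> down_cell G k (entry y) i ->
  exists x : k.+2.-tuple V, [/\ is_mgen G l x, up_cell G k.+1 (entry x) i
    & del_entry x (inord i.+1) = y].
Proof.
move=> gy /and5P[ik ay d1 dy qy]; have [d dd /andP[d0 _]] := mgen_dist gy ik.
case: d d0 dd => // d _ dd; have [u yu du] := dist_step dd.
have d_gt0 : 0 < d by case: d {du} dd d1 => // ->.
pose x := [tuple if (j <= i)%N then entry y j else
                 if j == i.+1 :> nat then u else entry y j.-1 | j < k.+2].
have xE j : j <= k.+1 -> entry x j =
    if j <= i then entry y j else if j == i.+1 then u else entry y j.-1.
  by move=> jk; rewrite /entry tnth_mktuple inordK.
have xlt j : j <= i -> entry x j = entry y j by move=> ji; rewrite xE ?ji//; lia.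
have xi : entry x i.+1 = u by rewrite xE ?ltnn ?eqxx//; lia.
have xgt j : i < j -> j <= k -> entry x j.+1 = entry y j.
  by move=> ij jk; rewrite xE// leqNgt (leqW ij)/= eqSS gtn_eqF.
have [a1 a2] := elimT (zigzagP _ _ _) ay.
have ax : zigzag G (entry x) i.+1.
  apply/zigzagP; split => j.
    rewrite ltnS leq_eqVlt => /orP[/eqP ->|ji]; first by rewrite xi xlt.
    by rewrite !xlt ?a1// ltnW.
  rewrite ltnS leq_eqVlt => /orP[/eqP ji|ji]; last by rewrite !xlt ?a2//; lia.
  rewrite ji xi xlt; last by lia.
  (* Both [u] and the entry before index [i] start geodesics along step [i], so they coincide and
     the zigzag continues. *)
  apply: (unique_stepP qy) => //; last 2 first.
  - by rewrite dd du.
  - by move: dy; rewrite -ji /= => /eqP.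
  - by rewrite adj_sym -ji; apply: a1; rewrite -ji.
have ux : up_cell G k.+1 (entry x) i.
  by apply/and4P; rewrite xi xlt// xgt// dd du.
have sx := up_cell_smooth ux.
have xy : del_entry x (inord i.+1) = y.
  apply: entry_inj => j jk; have [ji|ij] := leqP j i.
    by rewrite entry_del_lt ?xlt// ltnW.
  by rewrite entry_del_gt ?xgt.
exists x; split => //; apply/is_mgenP; have /is_mgenP[yN yl] := gy; split; last first.
  by rewrite -(mlength_del _ sx) ?xy// inordK; nat_lia.
move=> j jk; have [ji|ij|->] := ltngtP j i.
- by rewrite !xlt ?yN//; [apply: leq_ltn_trans ik; exact: ltnW|exact: ltnW].
- have [->|ji] := eqVneq j i.+1.
    rewrite xi xgt//; apply: contraTneq d_gt0 => uy.
    by move: du; rewrite uy dist_xx => -[<-].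
  case: j ij ji jk => // j ij; rewrite eqSS => ji jk.
  by rewrite !xgt ?yN//; nat_lia.
- by rewrite xi xlt// (adj_neq yu).
Qed.

(** If [w] lies on a geodesic from [a] to [b], the first vertex of a geodesic from [a] to [w] also
    starts one to [b], so it must be [u]. *)
Lemma unique_step_first (a u w b : V) : unique_step G a b -> adj G a u ->
  dist G a b = dadd (Some 1) (dist G u b) ->
  dist G a b = dadd (dist G a w) (dist G w b) -> dist G a b <> None -> w <> a ->
  dist G a w = dadd (Some 1) (dist G u w).
Proof.
move=> q au du + ab wa; rewrite /dadd.
case aw : (dist G a w) => [[|d]|]; [|case wb: (dist G w b) => [e|]|].
- by have := dist_eq0 G a w; rewrite aw eqxx => /esym/eqP /esym.
- move=> dab; have [v av vw] := dist_step aw.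
  have [f vb fde] := dist_triangle vw wb.
  suff -> : u = v by rewrite vw.
  apply: (unique_stepP q) => //; rewrite vb dab; congr Some.
  have jav : joined G a v 1 by apply: dist_joined; apply/eqP; rewrite dist_eq1.
  move: av; rewrite -(dist_eq1 G) => /eqP av.
  by have [g] := dist_triangle av vb; rewrite dab => -[?]; lia.
- by move=> /ab.
- by move=> /ab.
Qed.

(** The matched block of the boundary matrix has no entry off the matching, so it is a signed
    permutation matrix and not merely triangular. This replaces any argument about alternating
    paths. *)
Lemma matching_diagonal k l (x x' : k.+2.-tuple V) i i' (j : 'I_k.+2) :
  is_mgen G l x -> is_mgen G l x' ->
  up_cell G k.+1 (entry x) i -> up_cell G k.+1 (entry x') i' ->
  0 < j < k.+1 -> smooth G x' j -> del_entry x' j = del_entry x (inord i.+1) ->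
  x' = x /\ j = inord i.+1.
Proof.
move=> gx gx' ux ux' jk sj exx'.
have [y xy] : exists y, del_entry x (inord i.+1) = y by eexists.
have [] := up_cell_del gx ux; move: exx'; rewrite xy => yx' gy dy.
have /and5P[ik ay d1 dy' qy] := dy; have /zigzagP[a1 a2] := ay.
have x'lt t : t < j -> entry x' t = entry y t.
  move=> tj; rewrite -yx' entry_del; last by nat_lia.
  by rewrite /bump leqNgt tj.
have x'gt t : j <= t -> t <= k -> entry x' t.+1 = entry y t.
  by move=> jt tk; rewrite -yx' entry_del// /bump jt.
have fin' t : t < k.+1 -> dist G (entry x' t) (entry x' t.+1) <> None.
  by move=> tk; have [d ->] := mgen_dist gx' tk.
have [d [d' [dj dj' [dj0 dj0']]]] : exists d d',
   [/\ dist G (entry x' j.-1) (entry x' j) = Some d,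
       dist G (entry x' j) (entry x' j.+1) = Some d' & (0 < d /\ 0 < d')].
  have j1 : j.-1 < k.+1 by nat_lia.
  have j2 : j < k.+1 by nat_lia.
  have [d + /andP[d0 _]] := mgen_dist gx' j1; rewrite prednK; last by nat_lia.
  by have [d' d'E /andP[d'0 _]] := mgen_dist gx' j2; exists d, d'.
have {sj} sj : dist G (entry y j.-1) (entry y j) = Some (d + d').
  by move/eqP: sj; rewrite dj dj' -x'lt -?x'gt//; nat_lia.
(* The two steps around [j] merge into a step of [y] of length at least 2, which cannot be an edge
   of its initial zigzag. *)
have ij : i < j.
  rewrite ltnNge; apply/negP => ji.
  have := a1 j.-1; rewrite prednK; last by nat_lia.
  by rewrite -dist_eq1 sj => /(_ ji)/eqP[]; nat_lia.
have [ji|ij'|ji] := ltngtP j i.+1; first by nat_lia.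
  (* For [j > i.+1] the entries of [x'] up to [i.+1] are those of [y], so [x'] would be an up-cell
     and a down-cell at once. *)
  exfalso; apply: (@up_downF _ G k.+1 (entry x') i' i) => //.
  by apply: eq_down_cell dy => [|t ti]; [nat_lia | rewrite x'lt//; nat_lia].
rewrite ji /= in sj dj dj' x'lt x'gt.
split; last by apply: val_inj; rewrite /= inordK//; nat_lia.
apply: entry_inj => t tk.
have [ti|it|->] := ltngtP t i.+1.
- by rewrite x'lt// -xy entry_del_lt//; nat_lia.
- by case: t it tk => // t it tk; rewrite x'gt// -xy entry_del_gt.
set w := entry x' _.
have yi : entry y i = entry x i by rewrite -xy entry_del_lt//; nat_lia.
have yi1 : entry y i.+1 = entry x i.+2 by rewrite -xy entry_del_gt.
have /and4P[_ /zigzagP[ax1 _] /eqP dx _] := ux.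
have first_x : adj G (entry y i) (entry x i.+1).
  by rewrite yi; apply: ax1.
have dist_x : dist G (entry y i) (entry y i.+1) =
    dadd (Some 1) (dist G (entry x i.+1) (entry y i.+1)).
  by rewrite yi yi1.
rewrite x'lt// -/w in dj; move: dj'; rewrite -/w x'gt// => dj'.
have /and4P[ik' /zigzagP[a'1 a'2] /eqP dx' _] := ux'.
(* If [i <= i'], then [w] is adjacent to entry [i] and lies on a geodesic along step [i] of [y], so
   it is the unique first vertex. *)
have [ii'|ii'] := leqP i i'.
  have yw : adj G (entry y i) w by rewrite -x'lt// /w; apply: a'1.
  apply: (unique_stepP qy) => //; rewrite sj dj'.
  by move: yw; rewrite -(dist_eq1 G) dj => /eqP[->].
exfalso; have [i'i|i'i] := leqP i'.+2 i.
  apply: (up_cell_noreturn ux'); rewrite !x'lt//; last by nat_lia.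
  by apply: a2.
(* Here entry [i'] of [y] is the first vertex of the geodesic towards [w], hence closer to [w] than
   entry [i]; the up-cell condition on [x'] says the opposite. *)
have ei : i = i'.+1 by nat_lia.
subst i; rewrite /= in dy'.
have wy : w <> entry y i'.+1.
  by move=> ewy; move: dj; rewrite ewy dist_xx => -[?]; nat_lia.
have yy : adj G (entry y i'.+1) (entry y i') by rewrite adj_sym a1.
have := @unique_step_first _ _ w _ qy yy (eqP dy').
rewrite sj dj dj' => /(_ erefl) H; move: dx'; rewrite -/w (x'lt i') ?(x'lt i'.+1) ?dj//.
move=> yw; have := H ltac:(done) wy; rewrite yw => -[].
by nat_lia.
Qed.

End Matching.

Section CriticalCells.
Variables (V : finType) (G : sgraph V).

Lemma zigzag_entry (s : nat -> V) m j :
  zigzag G s m -> j <= m -> s j = if odd j then s 1 else s 0.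
Proof.
move=> /zigzagP[_ s2]; elim/ltn_ind: j => -[//|[//|j]] IH jm.
have jm1 : j.+1 < m by [].
by rewrite /= negbK (s2 _ jm1); apply: IH; nat_lia.
Qed.

Lemma zigzag_mlength k (x : k.+1.-tuple V) :
  zigzag G (entry x) k -> mlength G x = Some k.
Proof.
move=> /zigzagP[s1 _]; rewrite /mlength.
rewrite (eq_bigr (fun=> Some 1)); last first.
  by move=> i _; apply/eqP; rewrite dist_eq1 s1.
elim: k {x s1} => [|k IH]; first by rewrite big_ord0.
by rewrite big_ord_recl IH.
Qed.

Lemma zigzag_mgen k l (x : k.+1.-tuple V) :
  zigzag G (entry x) k -> is_mgen G l x = (l == k).
Proof.
move=> zx; apply/is_mgenP/eqP => [[_]|->].
  by rewrite zigzag_mlength// => -[].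
split; last exact: zigzag_mlength.
by move=> i ik; have /zigzagP[s1 _] := zx; exact/adj_neq/s1.
Qed.

End CriticalCells.

(** * Irregular tuples lie near cycles *)

Section IrregularCells.
Variables (V : finType) (G : sgraph V).

Lemma lazy_avoidingC (a b : V) : lazy_avoiding G a b = lazy_avoiding G b a.
Proof. by rewrite /lazy_avoiding (finset.setUC [set a]). Qed.

(** The geodesics from [a] and from [u] to [b] have equal length, so neither visits the start of the
    other; join them at [b]. *)
Lemma equidistant_detour (a u b : V) d : adj G a u ->
  dist G a b = Some d -> dist G u b = Some d ->
  walk (lazy_avoiding G a u) a u (d + d).
Proof.
move=> /adj_neq au ab ub; apply: (@walk_cat _ _ _ b).
  by rewrite lazy_avoidingC; exact: geodesic_avoids ab ub (leqnn _) au.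
apply: walk_sym; first exact: lazy_avoiding_sym.
by apply: geodesic_avoids ub ab (leqnn _) _; rewrite eq_sym.
Qed.

(** With two first steps [u] and [w], go from [a] to [w], on to [b], and back to [u]. The geodesics
    from [w] and [u] do not meet [a] again. *)
Lemma two_steps_detour (a b : V) d : ~~ unique_step G a b ->
  dist G a b = Some d ->
  exists2 u, adj G a u & walk (lazy_avoiding G a u) a u (d + d).
Proof.
move=> /forallPn[u /forallPn[w]]; rewrite negb_imply => /andP[].
move=> /and4P[au aw du dw] uw ab; move: du dw; rewrite ab => du dw.
exists u => //; move: du dw.
case ub: (dist G u b) => [e|]; last by [].
case wb: (dist G w b) => [f|]; last by [].
move=> /eqP[de] /eqP[df].
have refl := @lazy_avoiding_refl _ G a u.
have le : 1 + e + e <= d + d by nat_lia.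
apply: (walk_leq refl le).
have ef : f = e by nat_lia.
rewrite ef in wb; apply: (@walk_cat _ _ _ b); first apply: (@walk_cat _ _ _ w).
- exists [:: w]; rewrite /= /lazy_avoiding aw andbT; split => //.
  apply/orP; right; apply/eqP => /setP/(_ u); rewrite !inE eqxx orbT.
  by rewrite (negbTE uw) orbF eq_sym (negbTE (adj_neq au)).
- apply: geodesic_avoids wb ab _ _; first by nat_lia.
  by rewrite eq_sym (adj_neq aw).
- apply: walk_sym; first exact: lazy_avoiding_sym.
  apply: geodesic_avoids ub ab _ _; first by nat_lia.
  by rewrite eq_sym (adj_neq au).
Qed.

Definition regular_cell k (s : nat -> V) : bool :=
  [|| zigzag G s k, [exists i : 'I_k, up_cell G k s i]
    | [exists i : 'I_k, down_cell G k s i]].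

(** At the first step that breaks the zigzag, compare the distances to its end from its start and
    from the previous entry. The tuple is regular unless these are equal or a geodesic has two first
    steps, and each exception yields a detour. *)
Lemma irregular_cycle k l (x : k.+1.-tuple V) :
  is_mgen G l x -> ~~ regular_cell k (entry x) ->
  exists2 i, i <= k & exists2 u, adj G (entry x i) u &
    walk (lazy_avoiding G (entry x i) u) (entry x i) u (l.+1 + l.+1).
Proof.
set s := entry x => gx; rewrite !negb_or => /and3P[nz /existsPn nu /existsPn nd].
have up i : ~~ up_cell G k s i.
  by apply/negP => ui; have /and4P[ik _ _ _] := ui; move/negP: (nu (Ordinal (ltnW ik))).
have dn i : ~~ down_cell G k s i.
  by apply/negP => di; have /andP[ik _] := di; move/negP: (nd (Ordinal ik)).
have ex : exists m, ~~ zigzag G s m by exists k.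
have [m zm mk] : exists2 m, zigzag G s m /\ ~~ zigzag G s m.+1 & m < k.
  case: (ex_minnP ex) => -[|m] nzm minm.
    by case/negP: nzm; apply/zigzagP; split.
  by exists m; [split => //; apply/negPn/negP => /minm|apply: minm]; rewrite ?ltnn.
have two i j d : i <= k -> ~~ unique_step G (s i) (s j) ->
    dist G (s i) (s j) = Some d -> d <= l.+1 ->
  exists2 i, i <= k & exists2 u, adj G (s i) u &
    walk (lazy_avoiding G (s i) u) (s i) u (l.+1 + l.+1).
  move=> ik ui di dl; have [u su ws] := two_steps_detour ui di.
  exists i => //; exists u => //.
  by apply: walk_leq ws; [exact: lazy_avoiding_refl | nat_lia].
case: zm => zm nzm.
have [d dd /andP[d0 dl]] := mgen_dist gx mk; rewrite -/s in dd.
case: m => [|m] in mk zm nzm dd.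
  have d1 : dist G (s 0) (s 1) != Some 1.
    apply: contra nzm; rewrite dist_eq1 => s01; apply/zigzagP; split => //.
    by case.
  have [u|u] := boolP (unique_step G (s 0) (s 1)).
    by have := dn 0; rewrite /down_cell mk zm d1 u.
  by apply: (two _ _ _ _ u dd); lia.
have [z1 z2] := elimT (zigzagP _ _ _) zm.
have am : dist G (s m) (s m.+1) = Some 1 by apply/eqP; rewrite dist_eq1 z1.
have am' := am; rewrite dist_sym in am'.
have [e de el] := dist_triangle am dd.
have [f] := dist_triangle am' de; rewrite dd => -[<-] df.
(* The distances [e] and [d] start at adjacent vertices and differ by at most 1. A smaller [e] gives
   a down-cell or, when it is 0, a longer zigzag; a larger [e] gives an up-cell. *)
have [ed|ed|ed] := ltngtP e d.
- have dE : d = e.+1 by nat_lia.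
  have [u|u] := boolP (unique_step G (s m.+1) (s m.+2)); last first.
    by apply: (two _ _ _ _ u dd) => //; nat_lia.
  have e0 : e = 0.
    apply/eqP/negPn/negP => e0; move/negP: (dn m.+1); apply.
    by apply/and5P; rewrite dd /= de dE; split.
  exfalso; move/negP: nzm; apply; apply/zigzagP; split => j jm.
    have [->|jm'] := eqVneq j m.+1; last by apply: z1; nat_lia.
    by rewrite -dist_eq1 dd dE e0.
  have [->|jm'] := eqVneq j m; last by apply: z2; nat_lia.
  by apply/esym/eqP; rewrite -(dist_eq0 G) de e0.
- have eE : e = d.+1 by nat_lia.
  have [u|u] := boolP (unique_step G (s m) (s m.+2)); last first.
    by apply: (two _ _ _ _ u de) => //; nat_lia.
  by have := up m; rewrite /up_cell mk zm u de dd eE eqxx.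
- exists m; first by nat_lia.
  exists (s m.+1); first exact: z1.
  have le : d + d <= l.+1 + l.+1 by nat_lia.
  apply: (walk_leq (lazy_avoiding_refl _ _ _) le).
  by apply: equidistant_detour dd; rewrite ?z1// de ed.
Qed.

(** A common length for all walks needed: a detour costs at most [l.+1 + l.+1], a step of the tuple
    has at most [l] edges each replaced by a detour, and at most [k] steps are retraced. *)
Definition walk_unit (k l : nat) := k.+1 * (l.+1 * (l.+1 + l.+1)).

Lemma irregular_walks k l (x : k.+1.-tuple V) :
  is_mgen G l x -> ~~ regular_cell k (entry x) ->
  exists a a', [/\ adj G a a',
    forall i, i < k ->
      walk (lazy_avoiding G a a') (entry x i) (entry x i.+1) (walk_unit k l),
    walk (lazy_avoiding G a a') (entry x k) a (walk_unit k l)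
  & walk (lazy_avoiding G a a') a a' (walk_unit k l)].
Proof.
move=> gx nx; have [i ik [u iu wu]] := irregular_cycle gx nx.
have refl := @lazy_avoiding_refl _ G (entry x i) u.
have step j : j < k -> walk (lazy_avoiding G (entry x i) u) (entry x j) (entry x j.+1)
    (l.+1 * (l.+1 + l.+1)).
  move=> jk; have [d dd /andP[_ dl]] := mgen_dist gx jk.
  have := joined_detour _ wu (dist_joined dd) => /(_ isT); apply: (walk_leq refl).
  by rewrite leq_mul2r; nat_lia.
exists (entry x i), u; split => //.
- move=> j jk; apply: (walk_leq refl) (step _ jk).
  by rewrite /walk_unit mulSn leq_addr.
(* Retracing the tuple leads from its last entry back to entry [i], an end of the avoided edge. *)
- have back n : n <= k - i ->
      walk (lazy_avoiding G (entry x i) u) (entry x (i + n)) (entry x i)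
        (n * (l.+1 * (l.+1 + l.+1))).
    elim: n => [|n IH] nk; first by rewrite addn0 mul0n; exact: walk_refl.
    rewrite mulSn; apply: walk_cat (IH (ltnW nk)); rewrite addnS.
    by apply: walk_sym; [exact: lazy_avoiding_sym | apply: step; nat_lia].
  have := back _ (leqnn _); rewrite subnKC//; apply: (walk_leq refl).
  by rewrite /walk_unit leq_mul2r; nat_lia.
- apply: walk_leq wu => //.
  by rewrite /walk_unit; nat_lia.
Qed.

Lemma walk_chain (e : rel V) (f : nat -> V) n M :
  (forall i, i < n -> walk e (f i) (f i.+1) M) ->
  exists p, [/\ size p = n * M, path e (f 0) p
    & forall i, i <= n -> nth (f 0) (f 0 :: p) (i * M) = f i].
Proof.
elim: n => [|n IH] fM; first by exists [::]; split => // -[|].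
have [i ik|p [sp pp np]] := IH; first by apply: fM; rewrite ltnW.
have [q [sq pq lq]] := fM _ (ltnSn n).
have lp : last (f 0) p = f n.
  by rewrite -(np n (leqnn n)) -sp -[LHS](nth_last (f 0) (f 0 :: p)).
exists (p ++ q); rewrite size_cat sp sq mulSn addnC cat_path pp lp pq; split => //.
move=> i; rewrite leq_eqVlt ltnS => /orP[/eqP -> |ik].
  have -> : n.+1 * M = (size (f 0 :: (p ++ q))).-1.
    by rewrite /= size_cat sp sq mulSn addnC.
  by rewrite nth_last/= last_cat lp lq.
rewrite -cat_cons nth_cat /= sp ltnS leq_mul2r ik orbT.
exact: np.
Qed.

End IrregularCells.

(** * The square of the boundary map *)

Section BoundarySquare.
Variables (V : finType) (G : sgraph V).
Local Open Scope ring_scope.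

Definition face_ok k (x : k.+2.-tuple V) (i : 'I_k.+2) : bool :=
  (0 < i < k.+1)%N && smooth G x i.

(** The simplicial identity for iterated faces. *)
Lemma del_entry_comm k (x : k.+3.-tuple V) (i j : 'I_k.+2) : (i <= j)%N ->
  del_entry (del_entry x (widen_ord (leqnSn _) i)) j =
  del_entry (del_entry x (lift ord0 j)) i.
Proof.
move=> ij; apply: entry_inj => t tk.
have bt (a : 'I_k.+2) : (bump a t <= k.+1)%N by rewrite /bump; case: leqP; nat_lia.
rewrite !entry_del//; congr entry; rewrite /= /bump /=.
have [jt|tj] := leqP j t; have [it|ti] := leqP i t; rewrite ?add0n ?add1n;
  do 2 case: leqP; nat_lia.
Qed.

(** By the triangle inequality, both sides say that the distance from [u] to [z] is the sum of the
    three consecutive distances. *)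
Lemma smooth_add (u v w z : V) :
  dist G u v <> None -> dist G v w <> None -> dist G w z <> None ->
  (dist G u w == dadd (dist G u v) (dist G v w)) &&
    (dist G u z == dadd (dist G u w) (dist G w z)) =
  (dist G v z == dadd (dist G v w) (dist G w z)) &&
    (dist G u z == dadd (dist G u v) (dist G v z)).
Proof.
case uv : (dist G u v) => [a|//] _; case vw : (dist G v w) => [b|//] _.
case wz : (dist G w z) => [e|//] _.
have [f uw fab] := dist_triangle uv vw.
have [g vz gbe] := dist_triangle vw wz.
have [h uz hfe] := dist_triangle uw wz.
have [h'] := dist_triangle uv vz; rewrite uz => -[<-] hag.
by rewrite uw vz /=; apply/andP/andP => -[/eqP[?] /eqP[?]]; split; apply/eqP;
  congr Some; nat_lia.
Qed.

(** For [i < j] neither smoothness condition is affected by the other deletion; for [i = j] two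
    adjacent entries are removed and [smooth_add] applies. *)
Lemma face_ok_comm k l (x : k.+3.-tuple V) (i j : 'I_k.+2) : is_mgen G l x ->
  (i <= j)%N ->
  face_ok x (widen_ord (leqnSn _) i) &&
    face_ok (del_entry x (widen_ord (leqnSn _) i)) j =
  face_ok x (lift ord0 j) && face_ok (del_entry x (lift ord0 j)) i.
Proof.
move=> gx ij; rewrite /face_ok /=.
have [i0|i0] := posnP i; first by rewrite i0 /= andbF.
have [jk|jk] := ltnP j k.+1; last first.
  have j2 : (bump 0 j < k.+2)%N = false.
    by apply/negbTE; rewrite -leqNgt /bump add1n ltnS.
  by rewrite j2 !andbF.
have ik2 : (i < k.+2)%N by [].
have ik1 : (i < k.+1)%N by nat_lia.
have j0 : (0 < j)%N by nat_lia.
have jk2 : (bump 0 j < k.+2)%N by rewrite /bump add1n.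
rewrite ik2 ik1 j0 jk2 /=.
have fin t : (t < k.+2)%N -> dist G (entry x t) (entry x t.+1) <> None.
  by move=> tk; have [d ->] := mgen_dist gx tk.
set y := del_entry x (widen_ord _ i); set z := del_entry x (lift ord0 j).
have ylo t : (t < i)%N -> (t <= k.+1)%N -> entry y t = entry x t.
  by move=> tm tk; rewrite entry_del// /bump leqNgt tm.
have yhi t : (i <= t)%N -> (t <= k.+1)%N -> entry y t = entry x t.+1.
  by move=> tm tk; rewrite entry_del// /bump tm.
have zlo t : (t <= j)%N -> (t <= k.+1)%N -> entry z t = entry x t.
  by move=> tm tk; rewrite entry_del// /= /bump add1n leqNgt ltnS tm.
have zhi t : (j < t)%N -> (t <= k.+1)%N -> entry z t = entry x t.+1.
  by move=> tm tk; rewrite entry_del// /= /bump add1n tm.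
rewrite /smooth /= !/(bump 0 j) /= add1n /=.
have [ji|ji] := eqVneq (i : nat) j.
  rewrite -ji in zlo zhi *.
  rewrite (ylo i.-1) ?(yhi i) ?(yhi i.+1) ?(zlo i.-1) ?(zlo i) ?(zhi i.+1); try nat_lia.
  have ei : (i : nat) = i.-1.+1 by rewrite prednK.
  by apply: smooth_add;
    [have := fin i.-1; rewrite -ei; apply|exact: fin|apply: fin]; nat_lia.
have ej : j.-1.+1 = j by rewrite prednK.
rewrite (yhi j.-1) ?(yhi j) ?(yhi j.+1) ?(zlo i.-1) ?(zlo i) ?(zlo i.+1); try nat_lia.
by rewrite ej andbC.
Qed.

Lemma boundary_basis k l (t : k.+2.-tuple V) : is_mgen G l t ->
  boundary (basis_elt G l t) = gen_boundary G l t.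
Proof.
move=> gt; pose x : mgen G k.+1 l := Sub t gt.
rewrite /boundary (bigD1 x)//= big1 ?addr0 => [|y yx].
  by rewrite /basis_elt ffunE /= eqxx mulr1z.
rewrite /basis_elt ffunE; move: yx; rewrite -val_eqE /= => /negbTE ->.
by rewrite mulr0z.
Qed.

Lemma sum_cancel_pairs (A : zmodType) n (F : 'I_n.+1 -> 'I_n -> A) :
  (forall i j : 'I_n, (i <= j)%N ->
    F (widen_ord (leqnSn _) i) j = - F (lift ord0 j) i) ->
  \sum_(i < n.+1) \sum_(j < n) F i j = 0.
Proof.
move=> FN.
rewrite (eq_bigr (fun i : 'I_n.+1 => \sum_(j < n | (i <= j)%N) F i j +
                             \sum_(j < n | ~~ (i <= j)%N) F i j)); last first.
  by move=> i _; rewrite (bigID (fun j : 'I_n => (i <= j)%N)).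
rewrite big_split /= [X in _ + X]big_ord_recl big_ord_recr /=.
rewrite (big_pred0 _ _ _ (F ord_max)) => [|j]; last by rewrite leqNgt ltn_ord.
rewrite big_pred0_eq addr0 add0r (exchange_big_dep xpredT)//= -big_split.
rewrite big1//= => j _; apply/eqP; rewrite addr_eq0 -sumrN; apply/eqP.
rewrite [RHS](eq_bigl (fun i : 'I_n => (i <= j)%N)) => [|i].
  by apply: eq_bigr => i; exact: FN.
by rewrite /bump add1n -ltnNge ltnS.
Qed.

Lemma boundary_gen_boundary k l (t : k.+3.-tuple V) :
  is_mgen G l t -> boundary (gen_boundary G l t) = 0.
Proof.
move=> gt; rewrite raddf_sum /=.
rewrite big_mkcond /=.
rewrite (eq_bigr (fun i : 'I_k.+3 => \sum_(j < k.+2)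
    (if face_ok t i && face_ok (del_entry t i) j then
      basis_elt G l (del_entry (del_entry t i) j) *~ (-1) ^+ (i + j) else 0)));
  last first.
  move=> i _; rewrite -/(face_ok t i).
  have [/[dup] fi /andP[ik si]|_] := boolP (face_ok t i).
    rewrite raddfMz /= boundary_basis; last exact: is_mgen_del ik si gt.
    rewrite /gen_boundary mulrz_suml big_mkcond /=; apply: eq_bigr => j _.
    by rewrite -/(face_ok _ j) [(i + j)%N]addnC exprD mulrzA.
  by rewrite big1_eq.
apply: sum_cancel_pairs => i j ij.
rewrite (face_ok_comm gt ij) (del_entry_comm _ ij).
case: ifP => _; last by rewrite oppr0.
have -> : (-1) ^+ (lift ord0 j + i) = - (-1) ^+ (i + j) :> int.
  by rewrite /= /bump add1n addSn exprS mulN1r addnC.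
by rewrite mulrNz opprK.
Qed.

Lemma boundary_square k l (f : MC G k.+2 l) : boundary (boundary f) = 0.
Proof.
rewrite [boundary f]/boundary raddf_sum big1//= => x _; rewrite raddfMz /=.
by rewrite boundary_gen_boundary ?mul0rz//; exact: valP.
Qed.

End BoundarySquare.

(** * Ranks *)

Section HomologyClasses.
Variables (V : finType) (G : sgraph V) (k l : nat).
Local Open Scope ring_scope.
Local Open Scope quotient_scope.

Definition homology_class (z : cycle G k l) : MH G k l :=
  \pi_(Quotient.quot
    (GRing.ZmodClosed.clone (cycle G k l) (@is_boundary _ G k l) _)) z.

Lemma homology_class_surj (v : MH G k l) : exists z, homology_class z = v.
Proof. by exists (repr v); exact: reprK. Qed.

Lemma homology_class_eq0 z : (homology_class z == 0) = is_boundary z.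
Proof.
have := @Quotient.idealrBE _
  (GRing.ZmodClosed.clone (cycle G k l) (@is_boundary _ G k l) _) z 0.
rewrite subr0 raddf0 => H; exact: esym.
Qed.

Lemma homology_class_sum (I : finType) (z : I -> cycle G k l) (a : I -> int) :
  homology_class (\sum_i z i *~ a i) = \sum_i homology_class (z i) *~ a i.
Proof.
by rewrite /homology_class raddf_sum; apply: eq_bigr => i _; rewrite raddfMz.
Qed.

Lemma chain_of_cycle_sum (I : finType) (z : I -> cycle G k l) (a : I -> int) :
  chain_of_cycle (\sum_i z i *~ a i) = \sum_i chain_of_cycle (z i) *~ a i.
Proof.
transitivity (\sum_i (\val (z i *~ a i) : MC G k l)).
  exact: (raddf_sum (\val : cycle G k l -> MC G k l)).
by apply: eq_bigr => i _; exact: (raddfMz (\val : cycle G k l -> MC G k l)).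
Qed.

End HomologyClasses.

Section IntegralDependence.
Local Open Scope ring_scope.

(** A rational matrix with more rows than columns has a nonzero left kernel vector; multiplying it
    by the product of all its denominators makes it integral. *)
Lemma int_dependent r m (W : 'I_r -> 'I_m -> int) : (m < r)%N ->
  exists2 a : 'I_r -> int, (exists i, a i != 0) &
    forall j, \sum_i W i j * a i = 0.
Proof.
move=> mr; pose M := \matrix_(i < r, j < m) ((W i j)%:~R : rat).
have : kermx M != 0.
  rewrite -mxrank_eq0 mxrank_ker -lt0n subn_gt0.
  by apply: leq_ltn_trans mr; exact: rank_leq_col.
move=> /rowV0Pn[v]; rewrite sub_kermx => /eqP vM v0.
pose D i := \prod_(j | j != i) denq (v 0 j).
pose a i := numq (v 0 i) * D i.
have aE i : (a i)%:~R = v 0 i * (\prod_j denq (v 0 j))%:~R.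
  by rewrite /a intrM numqE -mulrA -intrM [in RHS](bigD1 i).
exists a.
  have [i vi] : exists i, v 0 i != 0.
    by apply/existsP; apply: contraNT v0 => /existsPn v0; apply/eqP/rowP => i;
      rewrite mxE; apply/eqP/negPn/v0.
  exists i; rewrite mulf_neq0 ?numq_eq0//; apply/prodf_neq0 => j _.
  by rewrite denq_neq0.
move=> j; apply: (@intr_inj rat); rewrite rmorph_sum mulr0z /=.
have := congr1 (fun A : 'rV_m => A 0 j * (\prod_j denq (v 0 j))%:~R) vM.
rewrite !mxE mul0r mulr_suml; apply: etrans; apply: eq_bigr => i _.
by rewrite mxE intrM aE mulrA [_ * v 0 i]mulrC.
Qed.

End IntegralDependence.

Section MatchingRank.
Variables (V : finType) (G : sgraph V).
Local Open Scope ring_scope.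

Lemma boundary_coef k l (f : MC G k.+1 l) (y : mgen G k l) :
  boundary f y = \sum_(x : mgen G k.+1 l)
    f x * \sum_(i < k.+2 | face_ok G (val x) i)
            (-1) ^+ i * (val y == del_entry (val x) i)%:R.
Proof.
rewrite /boundary sum_ffunE; apply: eq_bigr => x _.
rewrite ffunMzE mulrzz mulrC /gen_boundary sum_ffunE; congr (_ * _).
by apply: eq_bigr => i _; rewrite ffunMzE mulrzz mulrC ffunE.
Qed.

(** By [matching_diagonal], among all up-cells only [x] has [y] as a face, and only at position
    [i.+1]. *)
Lemma boundary_matched k l (f : MC G k.+1 l) x y i :
  (forall x', f x' != 0 -> exists j, up_cell G k.+1 (entry (val x')) j) ->
  up_cell G k.+1 (entry (val x)) i -> val y = del_entry (val x) (inord i.+1) ->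
  boundary f y = (-1) ^+ i.+1 * f x.
Proof.
move=> fup ux yx; have /and4P[ik _ _ _] := ux.
rewrite boundary_coef (bigD1 x)//= [X in _ + X]big1 ?addr0.
  rewrite mulrC (bigD1 (inord i.+1))/=; last first.
    by rewrite /face_ok (up_cell_smooth ux) andbT inordK; nat_lia.
  rewrite yx eqxx mulr1 inordK; last by nat_lia.
  rewrite [X in _ + X]big1 ?addr0// => j /andP[/andP[jk sj] ji].
  apply/eqP; rewrite mulf_eq0; apply/orP; right; apply/eqP; case: eqP => // e.
  have [_ /eqP] := matching_diagonal (valP x) (valP x) ux ux jk sj (esym e).
  by rewrite (negbTE ji).
move=> x' x'x; have [->|/fup[i' ux']] := eqVneq (f x') 0; first by rewrite mul0r.
rewrite big1 ?mulr0// => j /andP[jk sj]; rewrite yx.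
apply/eqP; rewrite mulf_eq0; apply/orP; right; apply/eqP; case: eqP => // e.
have [/val_inj/eqP] := matching_diagonal (valP x) (valP x') ux ux' jk sj (esym e).
by rewrite (negbTE x'x).
Qed.

(** A chain on up-cells whose boundary agrees with [f] at all down-cells; the sign cancels the one
    in the boundary. The inner default 0 never occurs, since the matched face of an up-cell is a
    generator. *)
Definition lift_down k l (f : MC G k l) : MC G k.+1 l :=
  [ffun x : mgen G k.+1 l =>
    (if [pick i : 'I_k.+1 | up_cell G k.+1 (entry (val x)) i] is Some i then
      (-1) ^+ i.+1 *
      (if insub (del_entry (val x) (inord i.+1)) is Some y then (f y : int) else 0)
    else 0) : int].

Lemma boundary_lift_down k l (f : MC G k l) (y : mgen G k l) i :
  down_cell G k (entry (val y)) i -> boundary (lift_down f) y = f y.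
Proof.
move=> dy; have [t [gt ut ty]] := down_cell_insert (valP y) dy.
pose x : mgen G k.+1 l := Sub t gt.
rewrite (@boundary_matched _ _ _ x _ i)//; last first.
  move=> x'; rewrite ffunE; case: pickP => [j uj _|_]; last by rewrite eqxx.
  by exists j.
rewrite ffunE; case: pickP => [j|/(_ (inord i))] /=; last first.
  by rewrite inordK ?ut//; have /andP[/ltnW] := ut.
move=> /(up_cell_index ut) <-; rewrite ty valK mulrA -exprD.
by rewrite -signr_odd addnn odd_double expr0 mul1r.
Qed.

Definition unmatched k l : {set mgen G k l} :=
  [set x | zigzag G (entry (val x)) k || ~~ regular_cell G k (entry (val x))].

(** Boundaries clear the down-cells from representing cycles. With too many classes, some integral
    combination also vanishes on the unmatched cells; it is then a cycle supported on up-cells,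
    hence zero. *)
Lemma int_free_MH_le k l r (v : 'I_r -> MH G k.+1 l) :
  int_free v -> (r <= #|unmatched k.+1 l|)%N.
Proof.
move=> vfree; rewrite leqNgt; apply/negP => lt_r.
have [z zE] := boolp.choice (fun i => homology_class_surj (v i)).
(* A homologous cycle with zero coefficients at the down-cells. *)
pose w i : MC G k.+1 l := chain_of_cycle (z i) - boundary (lift_down (z i)).
have [a [i ai] aE] :=
  int_dependent (fun i (j : 'I_#|unmatched k.+1 l|) => w i (enum_val j)) lt_r.
suff : forall i, a i = 0 by move/(_ i)/eqP; rewrite (negbTE ai).
apply: vfree; under eq_bigr do rewrite -zE.
rewrite -homology_class_sum; apply/eqP; rewrite homology_class_eq0.
apply/asboolP; exists (\sum_i lift_down (z i) *~ a i).
rewrite chain_of_cycle_sum raddf_sum /=; apply/eqP; rewrite -subr_eq0 -sumrB.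
set g := (X in X == 0).
have gE : g = \sum_i w i *~ a i.
  by apply: eq_bigr => j _; rewrite raddfMz /= -mulrzBl.
have g_cycle : boundary g = 0.
  rewrite gE raddf_sum big1// => j _; rewrite raddfMz /= raddfB /=.
  rewrite boundary_square subr0; case: (z j) => c /= /eqP ->.
  by rewrite mul0rz.
have gx x : g x = \sum_i w i x * a i.
  by rewrite gE sum_ffunE; apply: eq_bigr => j _; rewrite ffunMzE mulrzz.
have g_unmatched x : x \in unmatched k.+1 l -> g x = 0.
  by move=> xu; rewrite gx -[x](enum_rankK_in xu) ?aE.
have g_up x : g x != 0 -> exists j, up_cell G k.+1 (entry (val x)) j.
  move=> g0; have : x \notin unmatched k.+1 l.
    by apply: contraNN g0 => /g_unmatched ->.
  rewrite inE negb_or negbK => /andP[/negbTE nz]; rewrite /regular_cell nz /=.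
  move=> /orP[/existsP[j uj]|/existsP[j dj]]; first by exists j.
  move: g0; rewrite gx big1 ?eqxx// => t _.
  by rewrite !ffunE (boundary_lift_down _ dj) subrr mul0r.
(* A nonzero coefficient of [g] would reappear, up to sign, in its boundary at the matched face. *)
apply/eqP/ffunP => x; rewrite [RHS]ffunE; apply/eqP/negPn/negP => g0.
have [j uj] := g_up _ g0; have [gy _] := up_cell_del (valP x) uj.
have := boundary_matched (y := Sub _ gy) g_up uj (erefl _).
rewrite g_cycle ffunE => /esym/eqP; rewrite mulf_eq0 (negbTE g0) orbF.
by rewrite signr_eq0.
Qed.

End MatchingRank.

(** The bound [M] ensures that a maximal size exists, so [abrank] is not its default value. *)
Lemma abrank_bounds (A : zmodType) m M :
  (exists v : 'I_m -> A, int_free v) ->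
  (forall s (v : 'I_s -> A), int_free v -> s <= M) ->
  m <= abrank A <= M.
Proof.
move=> mfree Mfree; pose P s := `[< exists v : 'I_s -> A, int_free v >].
have exP : exists s, P s by exists m; exact/asboolP.
have PM s : P s -> s <= M by move=> /asboolP[v]; exact: Mfree.
have ex : exists r, (exists v : 'I_r -> A, int_free v) /\
    (forall s (v : 'I_s -> A), int_free v -> s <= r).
  have [r /asboolP vr maxr] := ex_maxnP exP PM; exists r; split => // s v vs.
  by apply: maxr; apply/asboolP; exists v.
rewrite /abrank; have [[v /Mfree rM] maxr] := xgetPex 0 ex.
by case: mfree => w /maxr ->.
Qed.

(** * The rank lies between two counts *)

Section RankEstimate.
Variables (V : finType) (G : sgraph V).

Definition adjacent_pairs : {set V * V} := [set xy | adj G xy.1 xy.2].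

Definition irregular k l : {set mgen G k l} :=
  [set x | ~~ regular_cell G k (entry (val x))].

Lemma big_dadd_leq k (F : 'I_k -> option nat) l :
  (forall i, F i <> Some 0) -> \big[dadd/Some 0]_(i < k) F i = Some l -> k <= l.
Proof.
elim: k F l => // k IH F l F0; rewrite big_ord_recl; have := F0 ord0.
case: (F ord0) => [[|d]|] // _; case E : (\big[_/_]_(_ < _) _) => [m|//] [<-].
by rewrite addSn ltnS; apply: leq_trans (IH _ _ _ E) (leq_addl _ _) => i.
Qed.

Lemma mgen_leq k l (x : k.+1.-tuple V) : is_mgen G l x -> k <= l.
Proof.
move=> gx; have /is_mgenP[xN] := gx; apply: big_dadd_leq => i /eqP.
by rewrite dist_eq0 (negbTE (xN _ (ltn_ord i))).
Qed.

(** A zigzag is determined by its first two entries, and its length equals its degree. *)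
Lemma card_unmatched k l :
  #|unmatched G k.+1 l| <= (k.+1 == l) * #|adjacent_pairs| + #|irregular k.+1 l|.
Proof.
pose Z := [set x : mgen G k.+1 l | zigzag G (entry (val x)) k.+1].
have -> : unmatched G k.+1 l = Z :|: irregular k.+1 l.
  by apply/setP => x; rewrite !inE.
apply: leq_trans (leq_card_setU _ _) _; rewrite leq_add2r.
case: eqP => [kl|/eqP kl]; last first.
  rewrite mul0n leqn0 cards_eq0; apply/eqP/setP => x; rewrite !inE.
  apply/negP => zx; have := zigzag_mgen l zx.
  by rewrite eq_sym (negbTE kl) (valP x).
rewrite mul1n; pose h (x : mgen G k.+1 l) := (entry (val x) 0, entry (val x) 1).
rewrite -(card_in_imset (f := h)); last first.
  move=> x y; rewrite !inE => zx zy [h0 h1]; apply/val_inj/entry_inj => i ik.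
  by rewrite (zigzag_entry zx ik) (zigzag_entry zy ik) h0 h1.
apply/subset_leq_card/fintype.subsetP => _ /imsetP[x + ->]; rewrite !inE.
by move=> /zigzagP[z1 _]; exact: z1.
Qed.

Definition zigzag_tuple k (a b : V) : k.+1.-tuple V :=
  [tuple if odd j then b else a | j < k.+1].

Lemma entry_zigzag_tuple k a b j : j <= k ->
  entry (zigzag_tuple k a b) j = if odd j then b else a.
Proof. by move=> jk; rewrite /entry tnth_mktuple inordK. Qed.

Lemma zigzag_tupleP k a b : adj G a b -> zigzag G (entry (zigzag_tuple k a b)) k.
Proof.
move=> ab; apply/zigzagP; split => j jk.
  rewrite !entry_zigzag_tuple//; last by rewrite ltnW.
  by rewrite /=; case: odd; rewrite //= adj_sym.
by rewrite !entry_zigzag_tuple ?negbK /= ?negbK//; nat_lia.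
Qed.

Local Open Scope ring_scope.

Lemma gen_boundary_zigzag k l (t : k.+2.-tuple V) :
  zigzag G (entry t) k.+1 -> gen_boundary G l t = 0.
Proof.
move=> /zigzagP[z1 z2]; rewrite /gen_boundary big1// => i /andP[/andP[i0 ik] /eqP].
have := z2 i.-1; rewrite prednK// => /(_ ik) ->; rewrite dist_xx.
have /eqP -> : dist G (entry t i.-1) (entry t i) == Some 1%N.
  by rewrite dist_eq1; have := z1 i.-1; rewrite prednK//; apply; exact: ltnW.
by case: dist.
Qed.

(** A zigzag has no smooth inner entry, because its neighbours there coincide; so its basis element
    is a cycle. Different starting pairs give different basis elements. *)
Lemma int_free_zigzag k :
  exists v : 'I_#|adjacent_pairs| -> MH G k.+1 k.+1, int_free v.
Proof.
pose t (i : 'I_#|adjacent_pairs|) :=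
  zigzag_tuple k.+1 (enum_val i).1 (enum_val i).2.
have zt i : zigzag G (entry (t i)) k.+1.
  by apply: zigzag_tupleP; have := enum_valP i; rewrite inE.
have gt i : is_mgen G k.+1 (t i) by rewrite (zigzag_mgen _ (zt i)).
have ct i : is_cycle (basis_elt G k.+1 (t i)).
  by rewrite /= boundary_basis// gen_boundary_zigzag.
exists (fun i => homology_class (Cycle (ct i))) => a.
rewrite -homology_class_sum => /eqP; rewrite homology_class_eq0 => /asboolP[f].
(* Each step of a generator has length at least 1, so there are no generators one degree higher and
   every boundary is 0. *)
rewrite chain_of_cycle_sum [RHS]big1 => [+ i|x _]; last first.
  by have := mgen_leq (valP x); rewrite ltnn.
move=> /ffunP/(_ (Sub _ (gt i))); rewrite sum_ffunE [RHS]ffunE.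
rewrite (bigD1 i)//= ffunMzE ffunE eqxx big1 ?addr0 => [|j ji].
  by rewrite mulrzz mul1r.
rewrite ffunMzE ffunE /=; case: eqP; rewrite ?mul0rz// => tij.
case/eqP: ji; apply/enum_val_inj.
have := congr1 (fun s => entry s 0) tij; have := congr1 (fun s => entry s 1) tij.
rewrite !entry_zigzag_tuple//=; case: (enum_val i) (enum_val j) => [? ?] [? ?] /=.
by move=> -> ->.
Qed.

Lemma rank_estimate k l :
  ((k.+1 == l) * #|adjacent_pairs| <= abrank (MH G k.+1 l)
    <= (k.+1 == l) * #|adjacent_pairs| + #|irregular k.+1 l|)%N.
Proof.
apply: abrank_bounds => [|s v vfree]; last first.
  exact: leq_trans (int_free_MH_le vfree) (card_unmatched _ _).
have [<-|_] := eqVneq k.+1 l; last by exists (fun=> 0) => a _ [].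
by rewrite mul1n; exact: int_free_zigzag.
Qed.

End RankEstimate.

(** * Counting irregular tuples *)

Section Trails.
Variables (V : finType).
Implicit Types (x y : V) (p : seq V).

Fixpoint trail x p : {set {set V}} :=
  if p is y :: p' then
    if x == y then trail y p' else [set x; y] |: trail y p'
  else finset.set0.

Lemma trail_sub x p e : e \in trail x p -> e \subset x :: p.
Proof.
elim: p x => [|y p IH] x; first by rewrite inE.
have sub z : z \in y :: p -> z \in x :: y :: p by move=> zp; rewrite inE zp orbT.
have tsub : e \in trail y p -> e \subset x :: y :: p.
  by move=> /IH/fintype.subsetP ey; apply/fintype.subsetP => z /ey/sub.
rewrite /=; case: eqP => [_ /tsub//|_]; rewrite inE => /orP[/set1P ->|/tsub//].
by apply/fintype.subsetP => z; rewrite !inE => /orP[] ->; rewrite ?orbT.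
Qed.

(* A connected graph has at most one more vertex than edges. *)
Lemma card_trail x p : #|[set z in x :: p]| <= #|trail x p|.+1.
Proof.
elim: p x => [|y p IH] x.
  rewrite finset.cards0 -(cards1 x) subset_leq_card//.
  by apply/fintype.subsetP => z; rewrite !inE.
rewrite [trail _ _]/=; have [->|xy] := eqVneq x y.
  rewrite (_ : [set z in _] = [set z in y :: p])//.
  by apply/setP => z; rewrite !inE orbA orbb.
have -> : [set z in x :: y :: p] = x |: [set z in y :: p].
  by apply/setP => z; rewrite !inE.
have [xp|xp] := boolP (x \in [set z in y :: p]).
  rewrite (finset.setUidPr _) ?finset.sub1set// (leq_trans (IH y))// ltnS.
  by rewrite subset_leq_card// finset.subsetUr.
(* A vertex not met later contributes a new edge, as the remaining trail only has edges among later
   vertices. *)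
rewrite cardsU1 xp add1n ltnS cardsU1 (_ : _ \notin _) ?add1n ?IH//.
apply: contraNN xp => /trail_sub/fintype.subsetP/(_ x).
by rewrite !inE eqxx; apply.
Qed.

Lemma trail_path (G : sgraph V) a b x p : path (lazy_avoiding G a b) x p ->
  trail x p \subset edges G /\ [set a; b] \notin trail x p.
Proof.
elim: p x => [|y p IH] x /=; first by rewrite finset.sub0set inE.
move=> /andP[/orP[/eqP -> /IH|/andP[xy nab] /IH[tG nt]]]; first by rewrite eqxx.
rewrite (negbTE (adj_neq xy)); split.
  by rewrite finset.subUset finset.sub1set tG andbT.
by rewrite !inE negb_or eq_sym nab.
Qed.

End Trails.

Section Witnesses.
Variables (V : finType) (L s t : nat).
Implicit Type h : L.+1.-tuple V.

Definition witness_edge h : {set V} := [set entry h s; entry h t].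

Definition witness_edges h : {set {set V}} :=
  witness_edge h |: trail (thead h) (behead h).

(* Adding the avoided edge to those of the walk gives a connected subgraph that
   contains a cycle. *)
Definition witness (G : sgraph V) h : bool :=
  path (lazy_avoiding G (entry h s) (entry h t)) (thead h) (behead h) &&
  adj G (entry h s) (entry h t).

(** The trail has at most one vertex more than edges, and the avoided edge, absent from the trail,
    makes up the difference. *)
Lemma witnessP G h : witness G h ->
  [/\ witness_edges h \subset edges G, witness_edges h \subset vpairs V
    & #|[set z in h]| <= #|witness_edges h|].
Proof.
move=> /andP[/trail_path[tG nt] st]; have wG : witness_edges h \subset edges G.
  by rewrite /witness_edges finset.subUset finset.sub1set tG andbT.
split=> //; first exact: fintype.subset_trans wG (edges_vpairs G).
have -> : [set z in h] = [set z in thead h :: behead h].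
  by apply/setP => z; rewrite !inE {1}(tuple_eta h) /= inE.
by rewrite cardsU1 nt add1n card_trail.
Qed.

End Witnesses.

Section CountIrregular.
Variables (V : finType) (k l : nat).
Let M := walk_unit k l.

(** An irregular tuple is recovered from its walk by reading every [M]-th vertex, so there are at
    most as many tuples as walks. *)
Lemma card_irregular (G : sgraph V) :
  #|irregular G k l| <=
  #|[set h : (k.+2 * M).+1.-tuple V | witness (k.+1 * M) (k.+2 * M) G h]|.
Proof.
pose sample (h : (k.+2 * M).+1.-tuple V) := [tuple entry h (i * M) | i < k.+1].
rewrite -(card_imset _ val_inj); set W := [set h | _].
apply: leq_trans (leq_imset_card sample W); apply/subset_leq_card.
apply/fintype.subsetP => _ /imsetP[x + ->]; rewrite inE => nx.
have [a [a' [aa' wx wa wa']]] := irregular_walks (valP x) nx.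
(* The walk passes through the tuple, then [a], then [a'], in [k.+2] segments of length [M]. *)
pose f i := if i <= k then entry (val x) i else if i == k.+1 then a else a'.
have [i ik2|p [sp pp fp]] := @walk_chain _ (lazy_avoiding G a a') f k.+2 M.
  rewrite /f; have [ik|ki|->] := ltngtP i k.
  - exact: wx.
  - have -> : i = k.+1 by nat_lia.
    by rewrite eqxx gtn_eqF.
  - by rewrite eqxx.
have sh : size (f 0 :: p) == (k.+2 * M).+1 by rewrite /= sp.
pose h := Tuple sh.
have hE i : i <= k.+2 -> entry h (i * M) = f i.
  move=> ik; rewrite /entry (tnth_nth (f 0)) /= inordK ?fp//.
  by rewrite ltnS leq_mul2r ik orbT.
apply/imsetP; exists h.
  rewrite inE /witness !hE//= /f ltnn eqxx ltnNge leqW// gtn_eqF//= aa' andbT.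
  by rewrite -/(f 0) /thead (tnth_nth (f 0)).
apply: entry_inj => i ik; rewrite {2}/entry tnth_mktuple inordK//.
by rewrite hE ?/f ?ik// leqW// leqW.
Qed.

End CountIrregular.

Section ExpectedIrregular.
Variables (R : realType) (V : finType) (mu : sgraph V -> R) (p : R).
Local Open Scope ring_scope.
Hypothesis mu_ge0 : forall g, 0 <= mu g.
Hypothesis mu_edges : forall A : {set {set V}}, A \subset vpairs V ->
  \sum_(g | A \subset edges g) mu g = p ^+ #|A|.
Hypothesis p01 : 0 <= p <= 1.

Lemma sum_tuple_cons m (F : m.+1.-tuple V -> R) :
  \sum_h F h = \sum_(t : m.-tuple V) \sum_x F [tuple of x :: t].
Proof.
rewrite (reindex (fun tx : m.-tuple V * V => [tuple of tx.2 :: tx.1])).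
  by rewrite -(pair_bigA _ (fun (t : m.-tuple V) x => F [tuple of x :: t])).
exists (fun h : m.+1.-tuple V => (behead_tuple h, thead h)) => [[t x]|h] _ /=.
  by congr (_, _); apply: val_inj.
by rewrite [RHS]tuple_eta; apply: val_inj.
Qed.

(** A further entry is either new, with at most [#|V|] choices and weight [p], or a repetition, with
    at most [m] choices and weight 1. *)
Lemma sum_tuple_card m :
  \sum_(h : m.-tuple V) p ^+ #|[set z in h]| <= \prod_(i < m) (#|V|%:R * p + i%:R).
Proof.
have /andP[p0 p1] := p01; elim: m => [|m IH].
  rewrite big_ord0 (big_pred1 [tuple]) => [|h]; last first.
    by apply/esym/eqP; exact: tuple0.
  by rewrite (_ : [set z in _] = finset.set0) ?finset.cards0//;
    apply/setP => z; rewrite !inE.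
rewrite sum_tuple_cons big_ord_recr /= mulrC.
apply: le_trans (ler_wpM2l _ IH); last by rewrite addr_ge0 ?mulr_ge0.
rewrite mulr_sumr ler_sum// => t _.
have E x : [set z in [tuple of x :: t]] = x |: [set z in t].
  by apply/setP => z; rewrite !inE.
under eq_bigr do rewrite E cardsU1 exprD.
rewrite -mulr_suml ler_wpM2r ?exprn_ge0//.
rewrite (bigID (fun x => x \in [set z in t]))/= addrC lerD//.
  apply: (@le_trans _ _ (\sum_(x : V) p)).
    rewrite [leRHS](bigID (fun x => x \in [set z in t]))/= addrC.
    rewrite -[leLHS]addr0 lerD ?sumr_ge0//.
    by rewrite ler_sum// => x ->.
  by rewrite sumr_const cardT -cardE mulr_natl.
rewrite (eq_bigr (fun=> 1)) => [|x ->//].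
have tm : (#|[set z in t]| <= m)%N.
  by rewrite cardsE (leq_trans (card_size t)) ?size_tuple.
by rewrite sumr_const ler_nat.
Qed.

(** A union bound over walks. All edges of a given walk are present with probability [p] to their
    number, which is at least the number of vertices; for [p = c / #|V|] the bound depends only on
    [c], [k] and [l]. *)
Lemma expected_irregular k l :
  \sum_g mu g * #|irregular g k l|%:R <=
  \prod_(i < (k.+2 * walk_unit k l).+1) (#|V|%:R * p + i%:R).
Proof.
have /andP[p0 p1] := p01.
set L := (k.+2 * walk_unit k l)%N; set s := (k.+1 * walk_unit k l)%N.
apply: le_trans (sum_tuple_card _).
apply: (@le_trans _ _ (\sum_g mu g * \sum_(h : L.+1.-tuple V | witness s L g h) 1)).
  rewrite ler_sum// => g _; rewrite ler_wpM2l// sumr_const ler_nat.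
  by apply: leq_trans (card_irregular _ _ _) _; rewrite cardsE.
under eq_bigr do rewrite mulr_sumr big_mkcond.
rewrite exchange_big /= ler_sum// => h _.
rewrite -big_mkcond /=.
(* The edge count depends on [h] alone, so a single graph for which [h] is a witness suffices to
   bound it. *)
have [g0 wg0|nw] := pickP (fun g => witness s L g h); last first.
  by rewrite big_pred0// exprn_ge0.
have [_ wV cW] := witnessP wg0.
apply: (@le_trans _ _ (p ^+ #|witness_edges s L h|)); last exact: ler_wiXn2l.
rewrite -mu_edges// big_mkcond [leRHS]big_mkcond ler_sum// => g _.
have [/witnessP[-> _ _]|_] := boolP (witness s L g h); first by rewrite mulr1.
by case: ifP.
Qed.

End ExpectedIrregular.

(** * Moments of the number of adjacent pairs *)

Section SecondMoment.
Variables (R : realType) (V : finType) (mu : sgraph V -> R) (p : R).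
Local Open Scope ring_scope.
Hypothesis mu_edges : forall A : {set {set V}}, A \subset vpairs V ->
  \sum_(g | A \subset edges g) mu g = p ^+ #|A|.
Hypothesis p0 : 0 <= p.

Let D : {set V * V} := [set u | u.1 != u.2].
Let edge (u : V * V) : {set V} := [set u.1; u.2].

Lemma edge_vpairs u : u \in D -> edge u \in vpairs V.
Proof. by rewrite !inE cards2 => ->. Qed.

Lemma card_distinct_pairs : #|D| = (#|V| * #|V|.-1)%N.
Proof.
have := cardsC D; rewrite card_prod.
have -> : ~: D = [set (x, x) | x in [set: V]].
  apply/setP => -[x y]; rewrite !inE negbK /=; apply/eqP/imsetP => [->|[z _ [-> ->]]//].
  by exists y.
rewrite card_imset; last by move=> x y [].
by rewrite cardsT; case: #|V| => [|n]; rewrite ?mulnS /=; nat_lia.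
Qed.

Lemma card_adjacent_pairs (g : sgraph V) :
  (#|adjacent_pairs g|)%:R = \sum_(u in D) (edge u \in edges g)%:R :> R.
Proof.
rewrite -sum1_card natr_sum big_mkcond [RHS]big_mkcond /=.
apply: eq_bigr => u _; rewrite !inE /edge -/(adj g _ _).
by case: ifP => [/adj_neq -> //|_]; case: ifP.
Qed.

Lemma sum_mu1 : \sum_g mu g = 1.
Proof.
have := mu_edges (finset.sub0set _); rewrite finset.cards0 expr0 => <-.
by apply: eq_bigl => g; rewrite finset.sub0set.
Qed.

Lemma sum_mu_edges (A : {set {set V}}) : A \subset vpairs V ->
  \sum_g mu g * (A \subset edges g)%:R = p ^+ #|A|.
Proof.
move=> /mu_edges <-; rewrite [RHS]big_mkcond; apply: eq_bigr => g _.
by case: ifP; rewrite ?mulr1 ?mulr0.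
Qed.

Lemma mean_adjacent_pairs :
  \sum_g mu g * (#|adjacent_pairs g|)%:R = #|D|%:R * p.
Proof.
under eq_bigr do rewrite card_adjacent_pairs mulr_sumr.
rewrite exchange_big /= (eq_bigr (fun=> p)) ?sumr_const ?mulr_natl// => u uD.
rewrite -[RHS]expr1 -(cards1 (edge u)) -sum_mu_edges ?finset.sub1set ?edge_vpairs//.
by apply: eq_bigr => g _; rewrite finset.sub1set.
Qed.

(** Expand the square over two ordered pairs: equal edges contribute [p], distinct edges
    [p ^+ 2]. *)
Lemma second_moment_adjacent_pairs :
  \sum_g mu g * (#|adjacent_pairs g|)%:R ^+ 2 <=
  2 * (#|D|%:R * p) + (#|D|%:R * p) ^+ 2.
Proof.
have E g : mu g * (#|adjacent_pairs g|)%:R ^+ 2 =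
    \sum_(u in D) \sum_(v in D) mu g * ([set edge u; edge v] \subset edges g)%:R.
  rewrite card_adjacent_pairs expr2 mulr_suml mulr_sumr; apply: eq_bigr => u _.
  rewrite !mulr_sumr; apply: eq_bigr => v _.
  by rewrite finset.subUset !finset.sub1set -natrM mulnb.
rewrite (eq_bigr _ (fun g _ => E g)) exchange_big /=.
have -> : 2 * (#|D|%:R * p) + (#|D|%:R * p) ^+ 2 =
    \sum_(u in D) (2 * p + #|D|%:R * p ^+ 2).
  by rewrite sumr_const -[RHS]mulr_natl; ring.
rewrite ler_sum// => u uD; rewrite exchange_big /=.
rewrite (eq_bigr (fun v => p ^+ #|[set edge u; edge v]|)); last first.
  by move=> v vD; rewrite sum_mu_edges// finset.subUset !finset.sub1set !edge_vpairs.
rewrite (bigID (fun v => edge v == edge u)) /= lerD//.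
  rewrite (eq_bigr (fun=> p)); last first.
    by move=> v /andP[_ /eqP ->]; rewrite finset.setUid cards1.
  rewrite sumr_const -[leLHS]mulr_natl ler_wpM2r// ler_nat.
  (* Only the pair itself and its reversal span the same edge. *)
  apply: leq_trans (_ : #|[set u; (u.2, u.1)]| <= 2)%N; last by rewrite cards2; case: eqP.
  apply/subset_leq_card/fintype.subsetP => -[x y].
  case: u uD => a b; rewrite !inE /edge /= => ab /andP[xy /eqP/setP e].
  have := e x; have := e y; rewrite !inE !eqxx orbT /= => /esym ey /esym ex.
  rewrite !xpair_eqE /=; move: xy; rewrite inE /=; case/orP: ex => /eqP ->;
    by case/orP: ey => /eqP ->; rewrite ?eqxx ?andbT /= ?orbT.
rewrite (eq_bigr (fun=> p ^+ 2)); last first.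
  by move=> v /andP[_ uv]; rewrite cards2 eq_sym uv.
rewrite sumr_const -[leLHS]mulr_natl ler_wpM2r ?exprn_ge0// ler_nat.
by apply/subset_leq_card/fintype.subsetP => v; rewrite unfold_in => /andP[].
Qed.

End SecondMoment.

(** * The random graph *)

Section MeanDeviation.
Variables (R : realType) (n : nat) (mu : sgraph 'I_n.+1 -> R) (c : R).
Local Open Scope ring_scope.
Let p : R := c / n.+1%:R.
Hypothesis mu_ge0 : forall g, 0 <= mu g.
Hypothesis mu_edges : forall A : {set {set 'I_n.+1}}, A \subset vpairs 'I_n.+1 ->
  \sum_(g | A \subset edges g) mu g = p ^+ #|A|.
Hypotheses (c_gt0 : 0 < c) (p_le1 : p <= 1).

Let m : R := n.+1%:R.
Let m_gt0 : 0 < m. Proof. by rewrite ltr0n. Qed.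
Let p_ge0 : 0 <= p. Proof. by rewrite divr_ge0// ltW. Qed.

Lemma edge_density_variance :
  \sum_g mu g * ((#|adjacent_pairs g|)%:R / m - c) ^+ 2 <= (2 * c + c ^+ 2) / m.
Proof.
pose A (g : sgraph 'I_n.+1) : R := (#|adjacent_pairs g|)%:R.
have -> : \sum_g mu g * (A g / m - c) ^+ 2 =
    (\sum_g mu g * A g ^+ 2) / m ^+ 2 - 2 * c / m * (\sum_g mu g * A g)
    + c ^+ 2 * \sum_g mu g.
  rewrite mulr_suml !mulr_sumr -sumrB -big_split /=; apply: eq_bigr => g _.
  by field; rewrite gt_eqF.
have m1 : m = n%:R + 1 by rewrite /m -natr1.
have n0 : 0 <= n%:R :> R by [].
have Dp : #|[set u : 'I_n.+1 * 'I_n.+1 | u.1 != u.2]|%:R * p = c * n%:R.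
  rewrite card_distinct_pairs card_ord /= natrM /p -/m.
  by field; rewrite gt_eqF.
have EA : \sum_g mu g * A g = c * n%:R.
  by rewrite -Dp; exact: mean_adjacent_pairs mu_edges.
have EA2 : \sum_g mu g * A g ^+ 2 <= 2 * (c * n%:R) + (c * n%:R) ^+ 2.
  by rewrite -Dp; exact: second_moment_adjacent_pairs mu_edges p_ge0.
rewrite EA (sum_mu1 mu_edges) mulr1.
apply: (@le_trans _ _ ((2 * (c * n%:R) + (c * n%:R) ^+ 2) / m ^+ 2 -
    2 * c / m * (c * n%:R) + c ^+ 2)).
  by rewrite !lerD2r ler_wpM2r// invr_ge0 exprn_ge0// ltW.
rewrite -subr_ge0.
(* There are [n.+1] vertices, so the mean is [c * n%:R] rather than [c * m]; the slack in the bound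
   absorbs this bias. *)
have -> : (2 * c + c ^+ 2) / m - ((2 * (c * n%:R) + (c * n%:R) ^+ 2) / m ^+ 2 -
    2 * c / m * (c * n%:R) + c ^+ 2) = (2 * c + c ^+ 2 * n%:R) / m ^+ 2.
  by rewrite m1; field; rewrite -m1 gt_eqF.
rewrite divr_ge0 ?exprn_ge0 ?addr_ge0 ?mulr_ge0 ?exprn_ge0//; exact: ltW.
Qed.

(** The rank deviates by at most the irregular count plus the deviation of the edge density. The
    parameter [t] turns the mean-square bound into a bound on the mean without square roots. *)
Lemma mean_deviation k l t : 0 < t ->
  \sum_g mu g * `| (abrank (MH g k.+1 l))%:R / m - c * (k.+1 == l)%:R | <=
  t / 2 + (\prod_(i < (k.+3 * walk_unit k.+1 l).+1) (c + i%:R)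
           + (2 * c + c ^+ 2) / (2 * t)) / m.
Proof.
move=> t_gt0; set K := \prod_(_ < _) _.
pose I (g : sgraph 'I_n.+1) : R := #|irregular g k.+1 l|%:R.
pose X (g : sgraph 'I_n.+1) : R := (#|adjacent_pairs g|)%:R / m - c.
have EI : \sum_g mu g * I g <= K.
  have p01 : 0 <= p <= 1 by rewrite p_ge0 p_le1.
  apply: le_trans (expected_irregular mu_ge0 mu_edges p01 _ _) _.
  by rewrite /K card_ord /p [_ * (c / _)]mulrC divfK// gt_eqF.
apply: (@le_trans _ _ (\sum_g mu g * (I g / m + (t / 2 + X g ^+ 2 / (2 * t))))).
  rewrite ler_sum// => g _; rewrite ler_wpM2l//.
  have /andP[r1 r2] := rank_estimate g k l.
  rewrite -(ler_nat R) natrM in r1; rewrite -(ler_nat R) natrD natrM in r2.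
  move: r1 r2.
  set r := (abrank _)%:R; set a := #|adjacent_pairs g|%:R; set d := (_ == _)%:R.
  rewrite -/(I g) => r1 r2.
  have -> : r / m - c * d = (r - d * a) / m + d * X g.
    by rewrite /X -/a; field; rewrite gt_eqF.
  apply: le_trans (ler_normD _ _) _; apply: lerD.
    rewrite ger0_norm; last by rewrite divr_ge0 ?subr_ge0// ltW.
    by rewrite ler_wpM2r ?invr_ge0 ?(ltW m_gt0)//; lra.
  apply: (@le_trans _ _ `|X g|).
    by rewrite normrM /d; case: (_ == _); rewrite ?normr1 ?normr0 ?mul1r ?mul0r.
  (* The inequality of arithmetic and geometric means, by completing the square. *)
  rewrite -subr_ge0 -[X g ^+ 2]real_normK ?num_real//.
  have -> : t / 2 + `|X g| ^+ 2 / (2 * t) - `|X g| = (t - `|X g|) ^+ 2 / (2 * t).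
    by field; rewrite gt_eqF.
  by rewrite divr_ge0 ?sqr_ge0// mulr_ge0// ltW.
have -> : \sum_g mu g * (I g / m + (t / 2 + X g ^+ 2 / (2 * t))) =
    (\sum_g mu g * I g) / m + t / 2 * (\sum_g mu g)
    + (\sum_g mu g * X g ^+ 2) / (2 * t).
  rewrite !mulr_suml mulr_sumr -!big_split /=; apply: eq_bigr => g _.
  by field; rewrite !gt_eqF.
rewrite (sum_mu1 mu_edges) mulr1.
have -> : t / 2 + (K + (2 * c + c ^+ 2) / (2 * t)) / m =
  K / m + t / 2 + (2 * c + c ^+ 2) / m / (2 * t) by field; rewrite !gt_eqF.
rewrite lerD ?lerD2r// ler_wpM2r ?invr_ge0 ?mulr_ge0 ?(ltW m_gt0) ?(ltW t_gt0)//.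
exact: edge_density_variance.
Qed.

End MeanDeviation.

(** * The finite law of the random graph *)

Section GraphLaw.
Local Open Scope classical_set_scope.
Local Open Scope ring_scope.
Context d (T : measurableType d) (R : realType) (P : probability T R).
Variables (n : nat) (p : R) (G : T -> sgraph 'I_n).
Hypothesis GP : erdos_renyi P p G.

Definition law (g : sgraph 'I_n) : R := fine (P [set w | G w = g]).

Lemma measurable_edge_event e : e \in vpairs 'I_n -> measurable (edge_event G e).
Proof. by case: GP => -[+ _] _; exact. Qed.

(** The event is a finite intersection of edge events and complements, since only pairs of distinct
    vertices can be edges. *)
Lemma measurable_graph_eq g : measurable [set w | G w = g].
Proof.
have -> : [set w | G w = g] = \bigcap_(e in [set` vpairs 'I_n])
    (if e \in edges g then edge_event G e else ~` edge_event G e).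
  apply/seteqP; split => [w /= <- e eV|w /= Gw].
    by case: ifPn => // /negP.
  apply/val_inj/setP => e /=; have [eV|neV] := boolP (e \in vpairs 'I_n); last first.
    have no (h : sgraph 'I_n) : e \in edges h = false.
      by apply: contraNF neV; exact/fintype.subsetP/edges_vpairs.
    by rewrite !no.
  have := Gw e eV; case: ifPn => [eg ew|_ /negP/negbTE //].
  exact: ew.
apply: fin_bigcap_measurable; first exact: finite_finpred.
move=> e eV; case: ifP => _; first exact: measurable_edge_event.
exact/measurableC/measurable_edge_event.
Qed.

Lemma measurable_graph_event (S : pred (sgraph 'I_n)) :
  measurable [set w | S (G w)].
Proof.
have -> : [set w | S (G w)] = \bigcup_(g in [set` S]) [set w | G w = g].
  apply/seteqP; split => [w Sw|w [g Sg /= ->]//].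
  by exists (G w).
apply: fin_bigcup_measurable; first exact: finite_finset.
by move=> g _; exact: measurable_graph_eq.
Qed.

Lemma lawE g : (law g)%:E = P [set w | G w = g].
Proof. by rewrite fineK// fin_num_measure//; exact: measurable_graph_eq. Qed.

Lemma law_ge0 g : 0 <= law g.
Proof. exact/fine_ge0/measure_ge0. Qed.

(** [G] takes finitely many values, so the integrand is a finite combination of indicators of
    measurable events. *)
Lemma expectation_graph (h : sgraph 'I_n -> R) : (forall g, 0 <= h g) ->
  ('E_P[fun w => h (G w)])%E = (\sum_g law g * h g)%:E.
Proof.
move=> h0; rewrite unlock.
transitivity (\int[P]_w (\sum_(g : sgraph 'I_n)
    ((h g)%:E * (\1_[set w | G w = g] w)%:E)))%E.
  apply: eq_integral => w _; rewrite (bigD1 (G w))//= indicE mem_set// mule1.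
  rewrite big1 ?adde0// => g gG; rewrite indicE memNset ?mule0// => Gg.
  by rewrite Gg eqxx in gG.
rewrite ge0_integral_sum//; last 2 first.
- move=> g; apply: measurable_funeM; apply/measurable_realfun.measurable_EFinP.
  exact/measurable_realfun.measurable_indic/measurable_graph_eq.
- by move=> g w _; rewrite mule_ge0 ?lee_fin.
rewrite -sumEFin; apply: eq_bigr => g _.
rewrite ge0_integralZl_EFin//; last first.
  apply/measurable_realfun.measurable_EFinP.
  exact/measurable_realfun.measurable_indic/measurable_graph_eq.
rewrite integral_indic//; last exact: measurable_graph_eq.
by rewrite setIT [in RHS]mulrC EFinM lawE.
Qed.

Lemma probability_graph (S : pred (sgraph 'I_n)) :
  P [set w | S (G w)] = (\sum_(g | S g) law g)%:E.
Proof.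
rewrite -expectation_indic; last exact: measurable_graph_event.
have -> : \1_[set w | S (G w)] = (fun w => (S (G w))%:R : R).
  apply/funext => w; rewrite indicE; congr (_%:R); congr nat_of_bool.
  by apply/idP/idP; rewrite inE.
rewrite (expectation_graph (h := fun g => (S g)%:R))//.
by rewrite [in RHS]big_mkcond; congr EFin; apply: eq_bigr => g _; case: (S g);
  rewrite ?mulr1 ?mulr0.
Qed.

Lemma law_edges (A : {set {set 'I_n}}) : A \subset vpairs 'I_n ->
  \sum_(g | A \subset edges g) law g = p ^+ #|A|.
Proof.
move=> AV; apply: EFin_inj; rewrite -(probability_graph (fun g => A \subset edges g)).
case: GP => -[_ indep] Pp.
have -> : [set w | A \subset edges (G w)] = \bigcap_(e in [set` A]) edge_event G e.
  apply/seteqP; split => [w /fintype.subsetP Aw e eA|w Aw]; first exact: Aw.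
  by apply/fintype.subsetP => e eA; exact: Aw.
rewrite indep// (eq_bigr (fun=> p%:E)); last first.
  by move=> e eA; apply/Pp/(fintype.subsetP AV).
rewrite prodEFin; congr EFin.
by rewrite prodr_const.
Qed.

End GraphLaw.

(** * Passage to the limit *)

Local Open Scope classical_set_scope.
Local Open Scope ring_scope.

Lemma deviation_vanishes (R : realType) (k l : nat) (c : R)
    (d : nat -> measure_display) (T : forall n : nat, measurableType (d n))
    (P : forall n : nat, probability (T n) R)
    (G : forall n : nat, T n -> sgraph 'I_n) (e : R) :
  0 < c ->
  (forall n : nat, c / n%:R <= 1 -> erdos_renyi (P n) (c / n%:R) (G n)) ->
  0 < e ->
  \forall n \near \oo, [/\ (0 < n)%N, erdos_renyi (P n) (c / n%:R) (G n) &
    \sum_g law (P n) (G n) g *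
      `| (abrank (MH g k.+1 l))%:R / n%:R - c * (k.+1 == l)%:R | <= e].
Proof.
move=> c0 hG e0.
pose B := \prod_(i < (k.+3 * walk_unit k.+1 l).+1) (c + i%:R)
          + (2 * c + c ^+ 2) / (2 * e).
have B0 : 0 <= B.
  apply: addr_ge0; first by apply: prodr_ge0 => i _; rewrite addr_ge0// ltW.
  by rewrite divr_ge0 ?addr_ge0 ?mulr_ge0 ?exprn_ge0// ltW.
(* The first summand makes the edge probability at most 1. The second makes [B] over the number of
   vertices at most [e / 2]; the other half of [e] comes from taking [t = e] in [mean_deviation]. *)
exists (Num.bound c + Num.bound (2 * B / e)).+1 => // -[//|n] /=; rewrite ltnS => Nn.
have cn : c <= n.+1%:R.
  apply: ltW; apply: lt_le_trans (archi_boundP (ltW c0)) _.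
  by rewrite ler_nat; nat_lia.
have Bn : 2 * B / e <= n.+1%:R.
  have B'0 : 0 <= 2 * B / e by rewrite divr_ge0 ?mulr_ge0// ltW.
  apply: ltW; apply: lt_le_trans (archi_boundP B'0) _.
  by rewrite ler_nat; nat_lia.
have n0 : 0 < n.+1%:R :> R by rewrite ltr0n.
have p1 : c / n.+1%:R <= 1 by rewrite ler_pdivrMr// mul1r.
have GP := hG _ p1; split => //.
apply: le_trans (mean_deviation (law_ge0 _ _) (law_edges GP) c0 p1 _ _ e0) _.
rewrite -/B [leRHS](splitr e) lerD2l ler_pdivrMr// mulrAC ler_pdivlMr//.
by move: Bn; rewrite ler_pdivrMr// mulrC [e * _]mulrC.
Qed.

Theorem theorem1p9 (R : realType) (k l : nat) (c : R)
    (d : nat -> measure_display) (T : forall n : nat, measurableType (d n))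
    (P : forall n : nat, probability (T n) R)
    (G : forall n : nat, T n -> sgraph 'I_n)
    (hk : (1 <= k)%N) (hl : (1 <= l)%N) (hc : 0 < c)
    (hG : forall n : nat, c / n%:R <= 1 -> erdos_renyi (P n) (c / n%:R) (G n)) :
  ('E_(P n)[fun w : T n => (abrank (MH (G n w) k l))%:R] * (n%:R^-1)%:E)%E
    @[n --> \oo] --> (c * (k == l)%:R)%:E
  /\
  forall eps : R, 0 < eps ->
    P n [set w : T n |
          eps < `| (abrank (MH (G n w) k l))%:R / n%:R - c * (k == l)%:R |]
      @[n --> \oo] --> 0%E.
Proof.
case: k hk => // k _.
have dev e : 0 < e -> _ := @deviation_vanishes R k l c d T P G e hc hG.
pose rk n (g : sgraph 'I_n) : R := (abrank (MH g k.+1 l))%:R.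
have rk_ge0 n g : 0 <= rk n g by [].
pose del : R := c * (k.+1 == l)%:R.
split.
  have EX n : erdos_renyi (P n) (c / n%:R) (G n) ->
      ('E_(P n)[fun w : T n => (abrank (MH (G n w) k.+1 l))%:R] * (n%:R^-1)%:E)%E
      = ((\sum_g law (P n) (G n) g * rk n g) / n%:R)%:E.
    by move=> GP; rewrite (expectation_graph GP (h := rk n))// EFinM.
  (* Finiteness is needed only eventually, once [c / n%:R <= 1] makes the law available. *)
  apply: cvg_EFin.
    have := dev _ ltr01; apply: filterS => n [_ GP _].
    by rewrite EX.
  apply/cvgrPdist_le => e e0; have := dev _ e0; apply: filterS => n [n0 GP].
  apply: le_trans; rewrite /= EX//= distrC -/del.
  (* The law has total mass 1, so the constant [del] can be moved under the mean. *)
  have -> : (\sum_g law (P n) (G n) g * rk n g) / n%:R - del =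
      \sum_g law (P n) (G n) g * (rk n g / n%:R - del).
    rewrite -[X in _ - X]mulr1 -(sum_mu1 (law_edges GP)).
    rewrite mulr_suml mulr_sumr -sumrB; apply: eq_bigr => g _.
    by rewrite mulrBr mulrA [del * _]mulrC.
  apply: le_trans (ler_norm_sum _ _ _) _; rewrite ler_sum// => g _.
  by rewrite normrM ger0_norm// law_ge0.
move=> eps eps0.
pose S n := [pred g : sgraph 'I_n | eps < `|rk n g / n%:R - del|].
have PS n : erdos_renyi (P n) (c / n%:R) (G n) ->
    P n [set w : T n | eps < `| (abrank (MH (G n w) k.+1 l))%:R / n%:R - del|] =
    (\sum_(g | S n g) law (P n) (G n) g)%:E.
  by move=> GP; rewrite -(probability_graph GP).
apply: cvg_EFin.
  have := dev _ ltr01; apply: filterS => n [_ GP _].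
  by rewrite PS.
apply/cvgrPdist_le => e e0; have := dev _ (mulr_gt0 e0 eps0).
apply: filterS => n [n0 GP le_dev]; rewrite /= PS//= sub0r normrN.
rewrite ger0_norm; last by apply: sumr_ge0 => g _; exact: law_ge0.
(* Markov's inequality on the finite law, which is why the mean deviation was bounded by
   [e * eps]. *)
rewrite -(ler_pM2r eps0); apply: le_trans le_dev.
rewrite mulr_suml big_mkcond ler_sum// => g _.
case: ifPn => [Sg|_]; last by rewrite mulr_ge0// law_ge0.
by rewrite ler_wpM2l ?law_ge0// ltW.
Qed.
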